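(* Let $H$ be Higman's group, i.e. the group with presentation $H=\langle a_i\ (i\in\mathbb Z/4\mathbb Z)\mid a_i a_{i+1} a_i^{-1}=a_{i+1}^2 \text{ for all } i\in \mathbb Z/4\mathbb Z\rangle$. Then $H$ is left-orderable, and hence $H$ admits a faithful action on the real line by homeomorphisms (i.e. an injective homomorphism $H\to\mathsf{Homeo}(\mathbb R)$).
   Context: A group $G$ is left-orderable if it admits a total order $\preceq$ such that $f\preceq g$ implies $hf\preceq hg$ for all $f,g,h\in G$. *)

(* Defs.v *)
From Stdlib Require Import Reals.
Open Scope R_scope.

Record Group := {
  carrier :> Type;
  gmul : carrier -> carrier -> carrier;
  gone : carrier;
  ginv : carrier -> carrier;
  gmul_assoc : forall x y z, gmul x (gmul y z) = gmul (gmul x y) z;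
  gmul_1l : forall x, gmul gone x = x;
  gmul_1r : forall x, gmul x gone = x;
  gmul_Vl : forall x, gmul (ginv x) x = gone;
  gmul_Vr : forall x, gmul x (ginv x) = gone
}.

Arguments gmul {g}.
Arguments gone {g}.
Arguments ginv {g}.

Inductive Z4 := i0 | i1 | i2 | i3.
Definition z4succ (i : Z4) : Z4 :=
  match i with i0 => i1 | i1 => i2 | i2 => i3 | i3 => i0 end.

Definition is_hom (G K : Group) (f : G -> K) : Prop :=
  forall x y : G, f (gmul x y) = gmul (f x) (f y).

Definition higman_relations (K : Group) (b : Z4 -> K) : Prop :=
  forall i : Z4,
    gmul (gmul (b i) (b (z4succ i))) (ginv (b i))
    = gmul (b (z4succ i)) (b (z4succ i)).

(* (G, a) is Higman's group: a presentation <a_i | relations>, i.e.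
   a satisfies the relations and (G,a) is universal among such. *)
Definition is_higman_group (G : Group) (a : Z4 -> G) : Prop :=
  higman_relations G a /\
  forall (K : Group) (b : Z4 -> K), higman_relations K b ->
    exists f : G -> K, is_hom G K f /\ (forall i, f (a i) = b i) /\
      forall g : G -> K, is_hom G K g -> (forall i, g (a i) = b i) ->
        forall x, g x = f x.

Definition left_orderable (G : Group) : Prop :=
  exists le : G -> G -> Prop,
    (forall x, le x x) /\
    (forall x y, le x y -> le y x -> x = y) /\
    (forall x y z, le x y -> le y z -> le x z) /\
    (forall x y, le x y \/ le y x) /\
    (forall f g h : G, le f g -> le (gmul h f) (gmul h g)).

Definition homeomorphism (f : R -> R) : Prop :=
  exists g : R -> R, continuity f /\ continuity g /\
    (forall x, g (f x) = x) /\ (forall x, f (g x) = x).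

Definition faithful_homeo_action (G : Group) : Prop :=
  exists rho : G -> (R -> R),
    (forall g, homeomorphism (rho g)) /\
    (forall g h x, rho (gmul g h) x = rho g (rho h x)) /\
    (forall g h, (forall x, rho g x = rho h x) -> g = h).

(* Main.v *)
(**
  Order [H] through sets rather than directly: consider totally ordered sets [X] with
  automorphisms [act i] and a labelling [lab : X -> H] such that [lab (act i x) = a i ** lab x].
  If such an [X] is nonempty and all four automorphisms satisfy Higman's relations, then [H]
  acts on [X], the labelling makes stabilizers trivial, and the orbit of a point orders [H].
  Labels thus replace normal forms for amalgamated products.

  A set with a family [S] of automorphisms can often be extended to one with a larger family
  [S'], and by inserting pieces at cuts this can be done relative to a subset on which [S']
  already acts. Alternating two such extensions [C < A] and [C < B] in an infinite chain gives
  a set on which the amalgam of [A] and [B] over [C] acts. The basic extensions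
  concern [a_i a_(i+1) a_i^-1 = a_(i+1)^2]: from [a_i] one uses [Z[1/2] x Y] with [a_i]
  doubling the first coordinate; from [a_(i+1)] one first adjoins all [2^n]-th roots of
  [a_(i+1)], and then [a_i] shifts the first coordinate of [Z x Y']. Gluing them extends
  sets with [a_0, a_2] to sets with [a_0, a_1, a_2] and, symmetrically, with [a_2, a_3, a_0],
  and [H] is the amalgam of the two corresponding groups over the free group on [a_0, a_2].

  Finally, a countable left-ordered [H] acts on [H x Q] ordered lexicographically; a back-and-forth
  identifies this set with a dense subset of the line, and the action extends by continuity.
*)
Require Import Defs.
From Stdlib Require Import Reals.
From Stdlib Require Import Cantor List ZArith Lia Lra.
From Stdlib Require Import ClassicalEpsilon FunctionalExtensionality.
From Stdlib Require Import PropExtensionality ProofIrrelevance.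
From Corelib Require Import ssreflect ssrfun ssrbool.

Set Bullet Behavior "None".
Set Implicit Arguments.
Unset Strict Implicit.
Unset Printing Implicit Defensive.

Local Notation "x ** y" := (gmul x y) (at level 40, left associativity).

(** * Groups, permutations and total preorders *)

Section Group_lemmas.
Context {G : Group}.
Implicit Types x y z g : G.

Lemma gmulK x y : x ** y ** ginv y = x.
Proof. by rewrite -gmul_assoc gmul_Vr gmul_1r. Qed.

Lemma gmulVK x y : x ** ginv y ** y = x.
Proof. by rewrite -gmul_assoc gmul_Vl gmul_1r. Qed.

Lemma gmulKl x y : ginv x ** (x ** y) = y.
Proof. by rewrite gmul_assoc gmul_Vl gmul_1l. Qed.

Lemma gmulVKl x y : x ** (ginv x ** y) = y.
Proof. by rewrite gmul_assoc gmul_Vr gmul_1l. Qed.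

Lemma gmulIr x y z : y ** x = z ** x -> y = z.
Proof. by move=> e; rewrite -(gmulK y x) e gmulK. Qed.

Lemma gmulIl x y z : x ** y = x ** z -> y = z.
Proof. by move=> e; rewrite -(gmulKl x y) e gmulKl. Qed.

Lemma ginv_uniq x y : x ** y = gone -> y = ginv x.
Proof. by move=> e; apply: (@gmulIl x); rewrite e gmul_Vr. Qed.

Lemma ginvK x : ginv (ginv x) = x.
Proof. by symmetry; apply: ginv_uniq; rewrite gmul_Vl. Qed.

Lemma ginv_mul x y : ginv (x ** y) = ginv y ** ginv x.
Proof. by symmetry; apply: ginv_uniq; rewrite gmul_assoc gmulK gmul_Vr. Qed.

Lemma ginv_one : ginv gone = gone :> G.
Proof. by symmetry; apply: ginv_uniq; rewrite gmul_1l. Qed.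

Definition gpow g (k : Z) : G :=
  match k with
  | Z0 => gone
  | Zpos p => Pos.iter (gmul g) gone p
  | Zneg p => Pos.iter (gmul (ginv g)) gone p
  end.

Lemma gpow_succ g k : gpow g (Z.succ k) = g ** gpow g k.
Proof.
case: k => [|p|p] //.
- by rewrite -Pos2Z.inj_succ /= Pos.iter_succ.
- elim/Pos.peano_ind: p => [|p _]; first by rewrite /= gmul_1r gmul_Vr.
  have -> : Z.succ (Z.neg (Pos.succ p)) = Z.neg p by lia.
  by rewrite /= Pos.iter_succ gmulVKl.
Qed.

Lemma gpow_pred g k : gpow g (Z.pred k) = ginv g ** gpow g k.
Proof. by apply: (@gmulIl g); rewrite -gpow_succ Z.succ_pred gmulVKl. Qed.

Lemma gpow_add g k l : gpow g (k + l) = gpow g k ** gpow g l.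
Proof.
elim/Z.peano_ind: k => [|k IH|k IH].
- by rewrite Z.add_0_l gmul_1l.
- by rewrite Z.add_succ_l !gpow_succ IH gmul_assoc.
- by rewrite Z.add_pred_l !gpow_pred IH gmul_assoc.
Qed.

Lemma gpow_1 g : gpow g 1 = g.
Proof. exact: gmul_1r. Qed.

Lemma gpow_opp g k : gpow g (- k) = ginv (gpow g k).
Proof. by apply: ginv_uniq; rewrite -gpow_add Z.add_opp_diag_r. Qed.

Lemma gpow_conj x g k : gpow (x ** g ** ginv x) k = x ** gpow g k ** ginv x.
Proof.
elim/Z.peano_ind: k => [|k IH|k IH].
- by rewrite /= gmul_1r gmul_Vr.
- by rewrite !gpow_succ IH !gmul_assoc gmulVK.
- by rewrite !gpow_pred IH !ginv_mul ginvK !gmul_assoc gmulVK.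
Qed.

Lemma gpow_comm g k l : gpow g k ** gpow g l = gpow g l ** gpow g k.
Proof. by rewrite -!gpow_add Z.add_comm. Qed.

Lemma gpow_sq g k : gpow (g ** g) k = gpow g (2 * k).
Proof.
elim/Z.peano_ind: k => [|k IH|k IH] //.
- have -> : (2 * Z.succ k = Z.succ (Z.succ (2 * k)))%Z by lia.
  by rewrite gpow_succ IH !gpow_succ gmul_assoc.
- have -> : (2 * Z.pred k = Z.pred (Z.pred (2 * k)))%Z by lia.
  by rewrite gpow_pred IH !gpow_pred ginv_mul gmul_assoc.
Qed.

End Group_lemmas.

Record perm (T : Type) := Perm {
  pfun :> T -> T;
  pinv : T -> T;
  pfunK : forall x, pinv (pfun x) = x;
  pinvK : forall x, pfun (pinv x) = x
}.

Lemma perm_ext T (p q : perm T) : (forall x, p x = q x) -> p = q.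
Proof.
case: p q => [f f' fK f'K] [g g' gK g'K] /= /functional_extensionality e.
subst g; have e : f' = g'.
  by apply: functional_extensionality => x; rewrite -[in LHS](g'K x) fK.
by subst g'; congr Perm; apply: proof_irrelevance.
Qed.

Definition perm_comp T (p q : perm T) : perm T.
Proof.
refine (@Perm T (fun x => p (q x)) (fun x => pinv q (pinv p x)) _ _).
- by move=> x; rewrite !pfunK.
- by move=> x; rewrite !pinvK.
Defined.

Definition Sym (T : Type) : Group.
Proof.
refine (@Build_Group (perm T) (@perm_comp T)
  (@Perm T id id (fun=> erefl) (fun=> erefl))
  (fun p => @Perm T (pinv p) p (@pinvK _ p) (@pfunK _ p)) _ _ _ _ _);
  move=> *; apply: perm_ext => ? //=; [exact: pfunK|exact: pinvK].
Defined.

Lemma perm_of_bij T (f : T -> T) :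
  (forall x y, f x = f y -> x = y) -> (forall y, exists x, f x = y) ->
  exists p : perm T, forall x, p x = f x.
Proof.
move=> inj surj.
pose g y := proj1_sig (constructive_indefinite_description _ (surj y)).
have fg y : f (g y) = y by rewrite /g; case: constructive_indefinite_description.
by exists (@Perm T f g (fun x => inj _ _ (fg (f x))) fg).
Qed.

(** * Total preorders, their ties and lexicographic products *)

Section Preorders.

Definition tpre {T} (le : T -> T -> Prop) : Prop :=
  (forall x y z, le x y -> le y z -> le x z) /\ (forall x y, le x y \/ le y x).

Definition eqv {T} (le : T -> T -> Prop) x y := le x y /\ le y x.

Definition lex {A B} (la : A -> A -> Prop) (lb : B -> B -> Prop) (x y : A * B) :=
  la x.1 y.1 /\ (la y.1 x.1 -> lb x.2 y.2).

Lemma tpre_refl {T} (le : T -> T -> Prop) : tpre le -> forall x, le x x.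
Proof. by move=> [_ t] x; case: (t x x). Qed.

Lemma tpre_lex A B (la : A -> A -> Prop) (lb : B -> B -> Prop) :
  tpre la -> tpre lb -> tpre (lex la lb).
Proof.
move=> [ta oa] [tb ob]; split=> [[x x'] [y y'] [z z']|[x x'] [y y']]; rewrite /lex /=.
- move=> [xy xy'] [yz yz']; split; first exact: ta xy yz.
  move=> zx; apply: tb (xy' _) (yz' _); [exact: ta yz zx|exact: ta zx xy].
- case: (classic (la x y)) => xy; case: (classic (la y x)) => yx; try tauto.
  + by case: (ob x' y'); tauto.
  + by case: (oa x y).
Qed.

Lemma tpre_pull A B (f : B -> A) (la : A -> A -> Prop) :
  tpre la -> tpre (fun x y => la (f x) (f y)).
Proof. by move=> [t o]; split=> [x y z|x y]; [apply: t|apply: o]. Qed.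

Lemma tpre_Rle : tpre Rle.
Proof. by split=> *; [apply: Rle_trans; eassumption|lra]. Qed.

Lemma eqv_trans {T} (le : T -> T -> Prop) x y z :
  tpre le -> eqv le x y -> eqv le y z -> eqv le x z.
Proof. by move=> [t _] [xy yx] [yz zy]; split; [apply: t yz|apply: t yx]. Qed.

Lemma eqv_sym {T} (le : T -> T -> Prop) x y : eqv le x y -> eqv le y x.
Proof. by case. Qed.

Lemma eqv_lex {A B} {la : A -> A -> Prop} {lb : B -> B -> Prop} {x y} :
  eqv (lex la lb) x y <-> eqv la x.1 y.1 /\ eqv lb x.2 y.2.
Proof. by rewrite /eqv /lex; tauto. Qed.

End Preorders.

(** * Ordered sets labelled by [H] *)

(* The family [act] carries information only for the generators in the set [S] of [pgood a S],
   [good a S] and [emb S]; outside [S] its values are junk. *)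
Record oset (H : Group) := Oset {
  car :> Type;
  le : car -> car -> Prop;
  lab : car -> H;
  act : Z4 -> car -> car
}.
Arguments Oset {H}.
Arguments le {H o} _ _.
Arguments lab {H o} _.
Arguments act {H o} _ _.

(* Axioms up to the equivalence of a total preorder; [good] adds antisymmetry. *)
Record pgood {H : Group} (a : Z4 -> H) (S : Z4 -> bool) (X : oset H) : Prop := {
  pg_tpre : tpre (@le H X);
  pg_lab : forall x y : X, eqv le x y -> lab x = lab y;
  pg_mono : forall i, S i -> forall x y : X, le (act i x) (act i y) <-> le x y;
  pg_act : forall i, S i -> forall x : X, lab (act i x) = a i ** lab x;
  pg_surj : forall i, S i -> forall y : X, exists x, eqv le (act i x) y;
  pg_rel : forall i, S i -> S (z4succ i) -> forall x : X,
    eqv le (act i (act (z4succ i) x)) (act (z4succ i) (act (z4succ i) (act i x)))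
}.

Definition good {H : Group} (a : Z4 -> H) (S : Z4 -> bool) (X : oset H) : Prop :=
  pgood a S X /\ forall x y : X, eqv le x y -> x = y.

Record emb {H : Group} (S : Z4 -> bool) (X Y : oset H) (f : X -> Y) : Prop := {
  emb_le : forall x y, le (f x) (f y) <-> le x y;
  emb_lab : forall x, lab (f x) = lab x;
  emb_act : forall i, S i -> forall x, eqv le (f (act i x)) (act i (f x))
}.
Arguments emb {H} S {X Y} f.

Definition ext {H : Group} (a : Z4 -> H) (S S' : Z4 -> bool) : Prop :=
  forall Y, good a S Y -> exists (Y' : oset H) (f : Y -> Y'), good a S' Y' /\ emb S f.

Section Osets.
Context {H : Group} {a : Z4 -> H}.
Implicit Types (S : Z4 -> bool) (X Y Z : oset H).

Lemma emb_eqv S X Y (f : X -> Y) : emb S f ->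
  forall x y, eqv le (f x) (f y) <-> eqv le x y.
Proof. by move=> e x y; rewrite /eqv !(emb_le e). Qed.

Lemma emb_act_eq S S' X Y (f : X -> Y) : emb S f -> good a S' Y ->
  forall i, S i -> forall x, f (act i x) = act i (f x).
Proof. by move=> e [_ g] i Si x; apply/g/(emb_act e). Qed.

Lemma emb_inj S S' X Y (f : X -> Y) : emb S f -> good a S' X ->
  forall x y, f x = f y -> x = y.
Proof.
move=> e g x y exy; apply: (proj2 g); apply/(emb_eqv e); rewrite exy.
have r z : le (f z) (f z) by apply/(emb_le e)/(tpre_refl (pg_tpre (proj1 g))).
by split.
Qed.

Lemma emb_sub S S' X Y (f : X -> Y) : (forall i, S' i -> S i) -> emb S f -> emb S' f.
Proof. by move=> s [e1 e2 e3]; split=> // i Si; apply/e3/s. Qed.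

Lemma emb_comp S S' X Y Z (f : X -> Y) (g : Y -> Z) :
  pgood a S' Z -> emb S f -> emb S g -> emb S (fun x => g (f x)).
Proof.
move=> gZ [f1 f2 f3] eg; case: (eg) => [g1 g2 g3]; split.
- by move=> x y; rewrite g1.
- by move=> x; rewrite g2.
- move=> i Si x; apply: (eqv_trans (pg_tpre gZ)) (g3 i Si _).
  by apply/(emb_eqv eg)/f3.
Qed.

Lemma pgood_sub S S' X : (forall i, S' i -> S i) -> pgood a S X -> pgood a S' X.
Proof. by move=> s [h1 h2 h3 h4 h5 h6]; split; auto. Qed.

Lemma good_sub S S' X : (forall i, S' i -> S i) -> good a S X -> good a S' X.
Proof. by move=> s [/(pgood_sub s) g an]; split. Qed.

Lemma good_inj S X : good a S X -> forall i, S i -> forall x y : X, act i x = act i y -> x = y.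
Proof.
move=> [g an] i Si x y e; apply: an.
have r := tpre_refl (pg_tpre g).
by split; apply/(pg_mono g Si); rewrite e.
Qed.

Lemma good_surj S X : good a S X -> forall i, S i -> forall y : X, exists x, act i x = y.
Proof. by move=> [g an] i Si y; have [x /an] := pg_surj g Si y; exists x. Qed.

Lemma good_perm S X : good a S X -> forall i, S i ->
  exists p : Sym X, forall x, p x = act i x.
Proof.
by move=> g i Si; have [p e] := perm_of_bij (good_inj g Si) (good_surj g Si); exists p.
Qed.

Lemma good_rel S X : good a S X -> forall i, S i -> S (z4succ i) -> forall x : X,
  act i (act (z4succ i) x) = act (z4succ i) (act (z4succ i) (act i x)).
Proof. by move=> [g an] i Si Sj x; apply/an/(pg_rel g). Qed.

Lemma pgood_refl S X : pgood a S X -> forall x : X, le x x.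
Proof. by move=> g; apply: tpre_refl (pg_tpre g). Qed.

Lemma pgood_eqv_refl S X : pgood a S X -> forall x : X, eqv le x x.
Proof. by move=> g x; split; apply: pgood_refl g _. Qed.

Lemma act_eqv S X : pgood a S X -> forall i, S i -> forall x y : X,
  eqv le (act i x) (act i y) <-> eqv le x y.
Proof. by move=> g i Si x y; rewrite /eqv !(pg_mono g Si). Qed.

(** Antisymmetry turns ties into equations, so constructions that only give [pgood] are passed
    through this lemma. The points are the classes of [eqv le]; a chosen section [r] supplies order,
    labels and action. *)
Lemma quotient S X : pgood a S X ->
  exists (Q : oset H) (q : X -> Q) (r : Q -> X),
    good a S Q /\ emb S q /\ emb S r /\ forall u, q (r u) = u.
Proof.
move=> g; have [tr to] := pg_tpre g; have rf := pgood_refl g.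
pose T := {P : X -> Prop | exists x, P = eqv le x}.
pose q (x : X) : T := exist _ (eqv le x) (ex_intro _ x erefl).
have r0 (u : T) : {x : X | q x = u}.
  apply: constructive_indefinite_description; case: u => P [x eP].
  by exists x; subst P; congr exist.
pose r u := proj1_sig (r0 u).
have qr u : q (r u) = u by rewrite /r; case: (r0 u).
have qe x y : q x = q y <-> eqv le x y.
  split=> [[e]|e]; first by rewrite e; split.
  have e' : eqv le x = eqv le y.
    apply: functional_extensionality => z; apply: propositional_extensionality.
    split=> e'; [apply: eqv_trans (pg_tpre g) (eqv_sym e) e'|].
    exact: eqv_trans (pg_tpre g) e e'.
  rewrite /q; move: (ex_intro _ x _) (ex_intro _ y _); rewrite e' => p1 p2.
  by congr exist; apply: proof_irrelevance.
have rq x : eqv le (r (q x)) x by apply/qe.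
pose Q := Oset T (fun u v => le (r u) (r v)) (fun u => lab (r u))
  (fun i u => q (act i (r u))).
have q_le x y : le (r (q x)) (r (q y)) <-> le x y.
  have [x1 x2] := rq x; have [y1 y2] := rq y.
  by split=> h; [apply: tr x2 (tr _ _ _ h y1)|apply: tr x1 (tr _ _ _ h y2)].
have gQ : good a S Q.
  split; last by move=> u v /qe; rewrite !qr.
  split.
  - have := tpre_pull r (pg_tpre g); exact.
  - by move=> u v /(pg_lab g).
  - by move=> i Si u v; rewrite /= q_le (pg_mono g).
  - by move=> i Si u; rewrite /= (pg_lab g (rq _)) (pg_act g).
  - move=> i Si u; have [x ex] := pg_surj g Si (r u).
    exists (q x); suff -> : @act H Q i (q x) = u by split; apply: rf.
    rewrite -[RHS]qr; apply/qe; apply: eqv_trans (pg_tpre g) _ ex.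
    exact/(act_eqv g).
  - move=> i Si Sj u /=; rewrite /eqv /= !q_le -/(eqv _ _ _).
    have ae k (Sk : S k) (x y : X) : eqv le x y -> eqv le (act k x) (act k y).
      by move/(act_eqv g Sk).
    apply: eqv_trans (pg_tpre g) _ (eqv_trans (pg_tpre g) (pg_rel g Si Sj (r u)) _).
      by apply: (ae) => //; exact: rq.
    apply: (ae) => //; apply: eqv_sym; apply: eqv_trans (pg_tpre g) (rq _) _.
    by apply: (ae) => //; exact: rq.
exists Q, q, r; split=> //; split; last split=> //.
- split=> [|x|i Si x]; [exact: q_le|exact: (pg_lab g (rq x))|].
  rewrite /eqv /= !q_le; apply: (proj2 (act_eqv g Si _ _)); exact: eqv_sym (rq x).
- split=> // i Si u; exact: rq.
Qed.

End Osets.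

(** * Extension relative to a subset *)

(* The extension of [X0 <= X1] is [X0] together with a copy of [X'] in every cut of [X0]; a point
   of [X1] outside [X0] goes to its copy in the cut that it defines. *)
Section Relative_extension.
Context {H : Group} {a : Z4 -> H}.
Context (S S' : Z4 -> bool) (SS' : forall i, S i -> S' i).
Context (X0 X1 X' : oset H) (f : X0 -> X1) (phi : X1 -> X').
Hypotheses (g0 : good a S' X0) (g1 : good a S X1) (g' : good a S' X').
Hypotheses (ef : emb S f) (ep : emb S phi).

Definition cut := {c : X0 -> Prop | forall x y, le x y -> c y -> c x}.
Definition cut_in (c : cut) x := proj1_sig c x.
Definition cut_le (c d : cut) := forall x, cut_in c x -> cut_in d x.

Definition cut_lower (u : X1) : cut.
Proof.
exists (fun x => le (f x) u) => x y xy yu.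
by apply: (proj1 (pg_tpre (proj1 g1))) yu; apply/(emb_le ef).
Defined.

(** The image of a cut under [act i] is a lower set because [act i] is onto and reflects the order,
    which is known only for [i] in [S']; elsewhere the cut is returned unchanged as a default. *)
Definition cut_act (i : Z4) (c : cut) : cut.
Proof.
case: (excluded_middle_informative (S' i)) => [Si|_]; last exact: c.
exists (fun x => exists2 z, x = act i z & cut_in c z) => x y xy [z ey cz].
have [z' ex] := good_surj g0 Si x.
exists z'; first by [].
by apply: (proj2_sig c) cz; apply/(pg_mono (proj1 g0) Si); rewrite ex -ey.
Defined.

Lemma cut_actP i c x : S' i -> cut_in (cut_act i c) (act i x) <-> cut_in c x.
Proof.
move=> Si; rewrite /cut_act; case: excluded_middle_informative => // Si'.
split=> [[z /(good_inj g0 Si) -> //]|cx].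
by exists x.
Qed.

Lemma tpre_cut : tpre cut_le.
Proof.
split=> [c d e cd de x /cd /de //|c d].
case: (classic (cut_le c d)) => [|N]; first by left.
have [x Nx] := not_all_ex_not _ _ N; have [cx dx] := imply_to_and _ _ Nx.
right=> y dy; case: (proj2 (pg_tpre (proj1 g0)) x y) => xy.
  by case: dx; apply: (proj2_sig d) dy.
exact: (proj2_sig c) cx.
Qed.

Lemma cut_act_le i c d : S' i -> cut_le (cut_act i c) (cut_act i d) <-> cut_le c d.
Proof.
move=> Si; split=> h x.
  by move=> /(cut_actP _ _ Si)/h/(cut_actP _ _ Si).
by have [z <-] := good_surj g0 Si x; move=> /(cut_actP _ _ Si)/h/(cut_actP _ _ Si).
Qed.

Definition option_le (u v : option X') :=
  match u, v with
  | None, _ => True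
  | Some p, Some q => le p q
  | Some _, None => False
  end.

Lemma tpre_option : tpre option_le.
Proof.
have [t o] := pg_tpre (proj1 g').
split=> [[x|] [y|] [z|] //=|[x|] [y|] /=]; try tauto; [exact: t|exact: o].
Qed.

(* [x] in [X0] sits immediately below the piece inserted at the cut [cut_lower (f x)]. *)
Definition rel_key (u : X0 + cut * X') : cut * option X' :=
  match u with
  | inl x => (cut_lower (f x), None)
  | inr (c, p) => (c, Some p)
  end.

Definition rel_oset : oset H := Oset (X0 + cut * X')
  (fun u v => lex cut_le option_le (rel_key u) (rel_key v))
  (fun u => match u with inl x => lab x | inr (c, p) => lab p end)
  (fun i u => match u with inl x => inl (act i x)
                         | inr (c, p) => inr (cut_act i c, act i p) end).

Definition key_act i (k : cut * option X') := (cut_act i k.1, option_map (act i) k.2).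

Lemma cut_lower_act i x : S' i ->
  eqv cut_le (cut_lower (f (act i x))) (cut_act i (cut_lower (f x))).
Proof.
move=> Si; split=> y; have [z <-] := good_surj g0 Si y.
- by move=> /(emb_le ef)/(pg_mono (proj1 g0) Si) zx; apply/(cut_actP _ _ Si)/(emb_le ef).
- move=> /(cut_actP _ _ Si)/(emb_le ef) zx; apply/(emb_le ef).
  exact/(pg_mono (proj1 g0) Si).
Qed.

Lemma tpre_key : tpre (lex cut_le option_le).
Proof. exact: tpre_lex tpre_cut tpre_option. Qed.

Lemma rel_key_act i (u : rel_oset) : S' i ->
  eqv (lex cut_le option_le) (rel_key (act i u)) (key_act i (rel_key u)).
Proof.
move=> Si; apply/eqv_lex; case: u => [x|[c p]] /=; split.
- exact: cut_lower_act.
- by [].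
- by split.
- by split; apply: (pgood_refl (proj1 g')).
Qed.

Lemma key_act_le i k l : S' i ->
  lex cut_le option_le (key_act i k) (key_act i l) <-> lex cut_le option_le k l.
Proof.
move=> Si; rewrite /lex /= !(cut_act_le _ _ Si).
suff -> : option_le (option_map (act i) k.2) (option_map (act i) l.2) <-> option_le k.2 l.2 by [].
by case: (k.2) (l.2) => [p|] [q|] //=; exact: (pg_mono (proj1 g') Si).
Qed.

(** The slot [None] keeps points of [X0] apart from inserted ones, so ties occur only inside [X0] or
    inside the copy of [X'] at a single cut. *)
Lemma rel_lab (u v : rel_oset) : eqv le u v -> lab u = lab v.
Proof.
case: u v => [x|[c p]] [y|[d q]] /eqv_lex [] /=.
- move=> [xy yx] _; congr lab; apply: (proj2 g0).
  by split; apply/(emb_le ef); [apply: xy|apply: yx]; apply: (pgood_refl (proj1 g1)).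
- by move=> _ [].
- by move=> _ [].
- by move=> _ /(pg_lab (proj1 g')).
Qed.

Lemma pgood_rel : pgood a S' rel_oset.
Proof.
have tk := tpre_key; have [t _] := tk.
split.
- exact: (tpre_pull rel_key tpre_key).
- exact: rel_lab.
- move=> i Si u v; have [u1 u2] := rel_key_act u Si; have [v1 v2] := rel_key_act v Si.
  rewrite -[X in _ <-> X]/(lex _ _ (rel_key u) (rel_key v)) -(key_act_le _ _ Si).
  by split=> h; [apply: t u2 (t _ _ _ h v1)|apply: t u1 (t _ _ _ h v2)].
- by move=> i Si [x|[c p]] /=; [exact: (pg_act (proj1 g0) Si)|exact: (pg_act (proj1 g') Si)].
- move=> i Si [x|[c p]].
  + have [z ez] := good_surj g0 Si x; exists (inl z).
    by rewrite /= ez; split; apply: (tpre_refl tk).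
  + have [q eq] := good_surj g' Si p.
    have dP x y : le x y -> cut_in c (act i y) -> cut_in c (act i x).
      by move=> xy; apply: (proj2_sig c); apply/(pg_mono (proj1 g0) Si).
    (* The cut that [cut_act i] carries to [c] is the preimage of [c] under [act i]. *)
    exists (inr (exist _ (fun x => cut_in c (act i x)) dP, q)).
    apply/eqv_lex; rewrite /= eq; split; last by split; apply: (pgood_refl (proj1 g')).
    by split=> x; have [z <-] := good_surj g0 Si x; rewrite (cut_actP _ _ Si).
- move=> i Si Sj [x|[c p]].
  + by rewrite /= (good_rel g0 Si Sj); split; apply: (tpre_refl tk).
  + apply/eqv_lex; rewrite /= (good_rel g' Si Sj); split.
      (* Writing [x] as [a_(i+1)^2 a_i z3], which equals [a_i a_(i+1) z3], reduces membership in
         either cut to [cut_in c z3]. *)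
      split=> x; have [z1 <-] := good_surj g0 Sj x; have [z2 <-] := good_surj g0 Sj z1;
        have [z3 <-] := good_surj g0 Si z2.
      * rewrite -(good_rel g0 Si Sj) (cut_actP _ _ Si) (cut_actP _ _ Sj).
        by rewrite (good_rel g0 Si Sj) !(cut_actP _ _ Sj) (cut_actP _ _ Si).
      * rewrite !(cut_actP _ _ Sj) (cut_actP _ _ Si).
        by rewrite -(good_rel g0 Si Sj) (cut_actP _ _ Si) (cut_actP _ _ Sj).
    by split; apply: (pgood_refl (proj1 g')).
Qed.

(** A point of [f X0] never ties with a point outside it, because [X1] is antisymmetric. Hence the
    former may go to [X0] and the latter into copies of [X'], where points defining the same cut are
    ordered by [phi]. *)
Lemma rel_emb : exists h : X1 -> rel_oset, emb S h /\ forall x, h (f x) = inl x.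
Proof.
pose h u : rel_oset :=
  match excluded_middle_informative (exists x, f x = u) with
  | left p => inl (proj1_sig (constructive_indefinite_description _ p))
  | right _ => inr (cut_lower u, phi u)
  end.
have hf x : h (f x) = inl x.
  rewrite /h; case: excluded_middle_informative => [p|]; last by case; exists x.
  by case: constructive_indefinite_description => z /= /(emb_inj ef g0) ->.
have hN u : ~ (exists x, f x = u) -> h u = inr (cut_lower u, phi u).
  by rewrite /h; case: excluded_middle_informative.
have [t1 o1] := pg_tpre (proj1 g1); have r1 := pgood_refl (proj1 g1).
have cN u v : le u v -> cut_le (cut_lower u) (cut_lower v).
  by move=> uv x /= xu; apply: t1 xu uv.
exists h; split=> //; split.
- move=> u v; case: (classic (exists x, f x = u)) => [[x <-{u}]|Nu];
    case: (classic (exists x, f x = v)) => [[y <-{v}]|Nv]; rewrite ?hf ?hN // /= /lex /=.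
  + split=> [[xy _]|xy]; first by apply: xy => /=; apply: r1.
    by split=> //; apply: cN.
  + split=> [[xy _]|xy]; first by apply: xy => /=; apply: r1.
    by split=> //; apply: cN.
  + split=> [[uy /(_ _) yu]|uy].
      case: (o1 u (f y)) => // yu'; case: yu; exact: cN.
    split=> [|yu]; first exact: cN.
    have yu' : le (f y) u by apply: yu => /=; apply: r1.
    by case: Nu; exists y; apply: (proj2 g1).
  + split=> [[uv uv']|uv].
      case: (o1 u v) => // vu; apply/(emb_le ep); apply: uv'; exact: cN.
    by split=> [|_]; [apply: cN|apply/(emb_le ep)].
- move=> u; case: (classic (exists x, f x = u)) => [[x <-{u}]|Nu]; rewrite ?hf ?hN //=.
    by rewrite (emb_lab ef).
  by rewrite (emb_lab ep).
- move=> i Si u; have Si' := SS' Si.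
  case: (classic (exists x, f x = u)) => [[x <-{u}]|Nu].
    by rewrite -(emb_act_eq ef g1 Si) !hf; split; apply: (tpre_refl tpre_key).
  (* The complement of the image is invariant too, since [act i] is onto on [X0] and injective on
     [X1]. *)
  have Nu' : ~ (exists x, f x = act i u).
    move=> [x]; have [z <-] := good_surj g0 Si' x.
    rewrite (emb_act_eq ef g1 Si) => /(good_inj g1 Si) e; apply: Nu; by exists z.
  rewrite !hN //; apply/eqv_lex; rewrite /= (emb_act_eq ep g' Si); split.
    split=> x; have [z <-] := good_surj g0 Si' x; rewrite (cut_actP _ _ Si') /=;
      by rewrite (emb_act_eq ef g1 Si) (pg_mono (proj1 g1) Si).
  by split; apply: (pgood_refl (proj1 g')).
Qed.

End Relative_extension.

(** Extending [X1] afresh would forget the action of [S'] on [X0]. The fresh extension [X']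
    therefore serves only for the inserted pieces, while [inl] keeps [X0] with its own action. *)
Lemma rel_ext (H : Group) (a : Z4 -> H) S S' (X0 X1 : oset H) (f : X0 -> X1) :
  ext a S S' -> (forall i, S i -> S' i) -> good a S' X0 -> good a S X1 -> emb S f ->
  exists (X2 : oset H) (h : X1 -> X2),
    good a S' X2 /\ emb S h /\ emb S' (fun x => h (f x)).
Proof.
move=> e SS' g0 g1 ef; have [X' [phi [g' ep]]] := e _ g1.
have gr := pgood_rel g0 g1 g' ef.
have [h [eh hf]] := rel_emb SS' g0 g1 g' ef ep.
have [Q [q [r [gQ [eq [er qr]]]]]] := quotient gr.
exists Q, (fun u => q (h u)); split=> //; split.
  by apply: emb_comp (proj1 gQ) eh _; apply: emb_sub eq.
suff : emb S' (fun x => h (f x)) by move=> e'; exact: emb_comp (proj1 gQ) e' eq.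
split=> [x y|x|i Si x].
- by rewrite (emb_le eh) (emb_le ef).
- by rewrite hf.
- by rewrite !hf; apply: (pgood_eqv_refl gr (inl (act i x))).
Qed.

(** * Adjoining roots of an automorphism *)

(* The pair [(t, x)] stands for [p^t x]. In each convex class of [p] choose a base point [rep x]; it
   cuts the class into copies of a fundamental domain, numbered by [height] and increasing under
   [p^(sgn r)], and real translates of the domain are compared lexicographically. *)
Section Root_order.
Context (Y : Type) (leY : Y -> Y -> Prop) (p : Sym Y).
Hypotheses (tp : tpre leY) (anti : forall x y, eqv leY x y -> x = y).
Hypotheses (mono : forall x y, leY (p x) (p y) <-> leY x y) (nofix : forall x, p x <> x).

Local Notation pw k := (pfun (gpow p k)).

Lemma pwD k l x : pw (k + l) x = pw k (pw l x).
Proof. by rewrite gpow_add. Qed.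

Lemma pw1 x : pw 1 x = p x.
Proof. by rewrite gpow_1. Qed.

Lemma pwVK k x : pw k (pw (- k) x) = x.
Proof. by rewrite -pwD Z.add_opp_diag_r. Qed.

Lemma pw_mono k x y : leY (pw k x) (pw k y) <-> leY x y.
Proof.
elim/Z.peano_ind: k x y => [|k IH|k IH] x y //.
- by rewrite -Z.add_1_r !pwD IH !pw1.
- rewrite -(IH x y) -(mono (pw (Z.pred k) x)) -!pw1 -!pwD.
  by have -> : (1 + Z.pred k = k)%Z by lia.
Qed.

Definition same_class x y := exists m n, leY (pw m x) y /\ leY y (pw n x).

Lemma same_class_refl x : same_class x x.
Proof. by exists Z0, Z0; split; apply: tpre_refl tp _. Qed.

Lemma same_class_sym x y : same_class x y -> same_class y x.
Proof.
move=> [m [n [mx nx]]]; exists (- n)%Z, (- m)%Z; split.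
  by rewrite -(pw_mono n) pwVK.
by rewrite -(pw_mono m) pwVK.
Qed.

Lemma same_class_trans x y z : same_class x y -> same_class y z -> same_class x z.
Proof.
move=> [m [n [mx nx]]] [m' [n' [my ny]]]; exists (m' + m)%Z, (n' + n)%Z.
rewrite !pwD; split.
  by apply: (proj1 tp) my; apply/pw_mono.
by apply: (proj1 tp) ny _; apply/pw_mono.
Qed.

Lemma same_class_pw k x : same_class x (pw k x).
Proof. by exists k, k; split; apply: tpre_refl tp _. Qed.

Definition rep x := epsilon (inhabits x) (same_class x).

Lemma repP x : same_class x (rep x).
Proof. by apply: epsilon_spec; exists x; apply: same_class_refl. Qed.

Lemma rep_eq x y : same_class x y -> rep x = rep y.
Proof.
move=> xy; rewrite /rep (proof_irrelevance _ (inhabits x) (inhabits y)); congr (epsilon _ _).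
apply: functional_extensionality => z; apply: propositional_extensionality.
split; [apply: same_class_trans (same_class_sym xy)|exact: same_class_trans xy].
Qed.

(** Classes are convex, so the comparison of two distinct classes does not depend on the points
    chosen in them. *)
Lemma class_le x y x' y' : leY x y -> ~ same_class x y ->
  same_class x x' -> same_class y y' -> leY x' y'.
Proof.
move=> xy N [_ [n [_ xn]]] [m [_ [ym _]]].
apply: (proj1 tp) xn (proj1 tp _ _ _ _ ym).
case: (proj2 tp (pw n x) (pw m y)) => // h; case: N; exists Z0, (- m + n)%Z; split=> //.
by rewrite -(pw_mono m) -pwD Z.add_assoc Z.add_opp_diag_r.
Qed.

Definition sgn (r : Y) : Z := if excluded_middle_informative (leY r (p r)) then 1%Z else (-1)%Z.

Lemma sgn2 r : (sgn r * sgn r = 1)%Z.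
Proof. by rewrite /sgn; case: excluded_middle_informative. Qed.

Lemma sgn_up r : leY r (pw (sgn r) r).
Proof.
rewrite /sgn; case: excluded_middle_informative => h; first by rewrite pw1.
by apply/(pw_mono 1); rewrite -pwD pw1; case: (proj2 tp r (p r)).
Qed.

Lemma sgn_lt r : ~ leY (pw (sgn r) r) r.
Proof.
move=> h; have e : pw (sgn r) r = r by apply: anti; split=> //; apply: sgn_up.
apply: (nofix (x := r)); move: e; rewrite /sgn; case: excluded_middle_informative => h' e.
  by rewrite -[RHS]e pw1.
by rewrite -[in LHS]e -pw1 -pwD.
Qed.

Lemma sgn_step r k l : (k <= l)%Z -> leY (pw (sgn r * k) r) (pw (sgn r * l) r).
Proof.
move=> kl; have -> : l = (k + Z.of_nat (Z.to_nat (l - k)))%Z by lia.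
elim: (Z.to_nat _) => [|n IH]; first by rewrite Z.add_0_r; apply: tpre_refl tp _.
apply: (proj1 tp) IH _.
have -> : (sgn r * (k + Z.of_nat (S n)) = sgn r * (k + Z.of_nat n) + sgn r)%Z by lia.
by rewrite pwD pw_mono; apply: sgn_up.
Qed.

(** The translates of the base point by powers of [p^(sgn r)] increase and lie on both sides of [x],
    so there is a last one below [x]. *)
Lemma height_ex x : exists N, forall k, leY (pw (sgn (rep x) * k) (rep x)) x <-> (k <= N)%Z.
Proof.
set r := rep x; set s := sgn r.
have [m [n [mx nx]]] : same_class r x by apply/same_class_sym/repP.
have ss : (s * s = 1)%Z by apply: sgn2.
have P1 : leY (pw (s * (s * m)) r) x by rewrite Z.mul_assoc ss Z.mul_1_l.
have P2 : ~ leY (pw (s * (s * n + 1)) r) x.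
  have -> : (s * (s * n + 1) = n + s)%Z by rewrite Z.mul_add_distr_l Z.mul_assoc ss; lia.
  move=> h; apply: (@sgn_lt r); rewrite -(pw_mono n) -pwD.
  exact: (proj1 tp) h nx.
have [k [K1 K2]] : exists k, leY (pw (s * k) r) x /\ ~ leY (pw (s * (k + 1)) r) x.
  (* The search starts at the exponent of [P1]; [d] bounds the number of steps left before that of
     [P2], where the translate exceeds [x]. *)
  have [d] : exists d : nat, (s * n + 1 <= s * m + Z.of_nat d)%Z.
    by exists (Z.to_nat (s * n + 1 - s * m)); lia.
  move: (s * m)%Z P1; elim: d => [|d IH] k K1 kd.
    by case: P2; apply: (proj1 tp) (sgn_step r _) K1; lia.
  case: (classic (leY (pw (s * (k + 1)) r) x)) => K2; last by exists k.
  by apply: IH K2 _; lia.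
exists k => l; split=> [K|lk].
  case: (Z_le_gt_dec l k) => // lk; case: K2.
  by apply: (proj1 tp) (sgn_step r _) K; lia.
by apply: (proj1 tp) (sgn_step r _) K1.
Qed.

Definition height x := proj1_sig (constructive_indefinite_description _ (height_ex x)).

Lemma heightP x k : leY (pw (sgn (rep x) * k) (rep x)) x <-> (k <= height x)%Z.
Proof. by rewrite /height; case: constructive_indefinite_description. Qed.

Lemma rep_p x : rep (p x) = rep x.
Proof. by apply/rep_eq/same_class_sym; rewrite -pw1; apply: same_class_pw. Qed.

Lemma height_p x : (height (p x) = height x + sgn (rep x))%Z.
Proof.
have ss := sgn2 (rep x).
suff h k : (k <= height (p x) <-> k - sgn (rep x) <= height x)%Z.
  by have := h (height (p x)); have := h (height x + sgn (rep x))%Z; lia.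
rewrite -!heightP rep_p -(mono _ x) -(pw1 (pw _ _)) -pwD.
by have -> : (1 + sgn (rep x) * (k - sgn (rep x)) = sgn (rep x) * k)%Z by lia.
Qed.

Lemma height_mono x y : rep x = rep y -> leY x y -> (height x <= height y)%Z.
Proof. by move=> e xy; apply/heightP; rewrite -e; apply: (proj1 tp) _ xy; apply/heightP; lia. Qed.

(** With [s = sgn r], [h] the height of [x] and [y = p^(-s h) x] the remainder in the fundamental
    domain, [p^t x] is [p^(s (s t + h)) y], as [s^2 = 1]. The key lists the base point, the real
    position [s t + h] and [y]. *)
Definition root_key (u : R * Y) :=
  let r := rep u.2 in
  (r, (IZR (sgn r) * u.1 + IZR (height u.2), pw (- (sgn r * height u.2)) u.2)).

Definition root_le u v := lex leY (lex Rle leY) (root_key u) (root_key v).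

Lemma rep_le x y : rep x <> rep y -> (leY (rep x) (rep y) <-> leY x y).
Proof.
move=> N; have Nc : ~ same_class x y by move=> /rep_eq.
split=> h; last exact: class_le h Nc (repP x) (repP y).
apply: class_le h _ (same_class_sym (repP x)) (same_class_sym (repP y)) => h.
apply: Nc; apply: same_class_trans (repP x) _.
exact: same_class_trans h (same_class_sym (repP y)).
Qed.

(** Once the base points agree, a translation by [s] changes both positions by the same [sgn r * s].
    At exponent 0, height and remainder together recover the order inside a class. Equal keys have
    equal remainders, which gives the fourth clause; passing from [x] to [p x] changes the height by
    [sgn r], as adding 1 to the exponent changes the position. *)
Lemma root_order : exists rle : R * Y -> R * Y -> Prop,
  [/\ tpre rle,
      forall s u v, rle (u.1 + s, u.2) (v.1 + s, v.2) <-> rle u v,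
      forall x y, rle (0, x) (0, y) <-> leY x y,
      forall u v, eqv rle u v -> exists k, u.1 = v.1 + IZR k /\ v.2 = pw k u.2 &
      forall e x, eqv rle (e + 1, x) (e, p x)].
Proof.
have anti1 x y : leY x y -> leY y x -> x = y by move=> *; apply: anti.
exists root_le; split.
- exact: (tpre_pull root_key (tpre_lex tp (tpre_lex tpre_Rle tp))).
- move=> s [e x] [e' y]; rewrite /root_le /lex /=; split; move=> [h1 h2]; split=> // h3;
    have := h2 h3; rewrite (anti1 _ _ h1 h3); set S := IZR (sgn _);
    by move=> [h4 h5]; split=> [|h6]; [lra|apply: h5; lra].
- move=> x y; rewrite /root_le /lex /= !Rmult_0_r !Rplus_0_l.
  case: (classic (rep x = rep y)) => [e|N].
    rewrite e; have r := tpre_refl tp (rep y); split.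
      move=> [_ /(_ r) [/le_IZR h1 h2]].
      case: (proj2 tp x y) => // yx; have h := height_mono (esym e) yx.
      have eh : height x = height y by lia.
      by apply/(pw_mono (- (sgn (rep y) * height y))); move: h2; rewrite eh; apply; lra.
    move=> xy; split=> // _; split; first exact/IZR_le/height_mono.
    move=> /le_IZR h; have h' := height_mono e xy.
    have -> : height x = height y by lia.
    exact/pw_mono.
  rewrite -(rep_le N); split=> [[]|h] //; split=> // h'.
  by case: N; apply: anti1.
- move=> [e x] [e' y] h.
  have {h} : eqv (lex leY (lex Rle leY)) (root_key (e, x)) (root_key (e', y)) by [].
  move=> /eqv_lex [/= /anti er /eqv_lex [/= [h1 h2] /anti]].
  move: h1 h2; rewrite er; set s := sgn _ => h1 h2 h3.
  have ss : (s * s = 1)%Z by apply: sgn2.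
  exists (s * (height y - height x))%Z; split.
    have ss' : IZR s * IZR s = 1 by rewrite -mult_IZR ss.
    have h4 : IZR s * e + IZR (height x) = IZR s * e' + IZR (height y) by lra.
    have h5 : IZR s * (IZR s * e + IZR (height x)) = IZR s * (IZR s * e' + IZR (height y)).
      by rewrite h4.
    rewrite mult_IZR minus_IZR; move: h5; rewrite !Rmult_plus_distr_l -!Rmult_assoc ss'; lra.
  have -> : (s * (height y - height x) = s * height y + - (s * height x))%Z by lia.
  by rewrite pwD h3 pwVK.
- move=> e x; suff : eqv (lex leY (lex Rle leY)) (root_key (e + 1, x)) (root_key (e, p x)) by [].
  apply/eqv_lex; rewrite /= rep_p height_p; split.
    by split; apply: tpre_refl tp _.
  apply/eqv_lex; rewrite /= plus_IZR; split; first by split; lra.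
  rewrite -pw1 -pwD.
  set s := sgn _; have ss : (s * s = 1)%Z by apply: sgn2.
  have -> : (- (s * (height x + s)) + 1 = - (s * height x))%Z by nia.
  by split; apply: tpre_refl tp _.
Qed.

End Root_order.

(** * Extensions along the relation of a_i and a_(i+1) *)

(* [dyadic v h] says that [h] is the [v]-th power of [t], the [2^n]-th root being
   [s^-n t s^n]. *)
Section Dyadic_powers.
Context {G : Group} (s t : G) (st : s ** t ** ginv s = t ** t).

Definition dyadic_conj (k : Z) (n : nat) : G :=
  ginv (gpow s (Z.of_nat n)) ** gpow t k ** gpow s (Z.of_nat n).

Definition dyadic (v : R) (h : G) : Prop :=
  exists (k : Z) (n : nat), v * 2 ^ n = IZR k /\ h = dyadic_conj k n.

Lemma conj_gpow k : s ** gpow t k ** ginv s = gpow t (2 * k).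
Proof. by rewrite -gpow_conj st gpow_sq. Qed.

Lemma gpow_commg (g : G) k : g ** gpow g k = gpow g k ** g.
Proof. by rewrite -{1 4}(gpow_1 g) gpow_comm. Qed.

Lemma gpow_S g n : gpow g (Z.of_nat (S n)) = g ** gpow g (Z.of_nat n) :> G.
Proof. by rewrite Nat2Z.inj_succ gpow_succ. Qed.

Lemma dyadic_conjS k n : dyadic_conj k n = dyadic_conj (2 * k) (S n).
Proof.
by rewrite /dyadic_conj -conj_gpow gpow_S ginv_mul !gmul_assoc !gmulVK.
Qed.

Lemma dyadic_conj_add k n m : dyadic_conj k n = dyadic_conj (2 ^ Z.of_nat m * k) (m + n).
Proof.
elim: m => [|m IH]; first by rewrite Z.mul_1_l.
rewrite IH dyadic_conjS Nat2Z.inj_succ Z.pow_succ_r; first lia.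
by rewrite Z.mul_assoc.
Qed.

Lemma pow2_IZR n : 2 ^ n = IZR (2 ^ Z.of_nat n).
Proof. by rewrite -pow_IZR. Qed.

(** Both representations can be brought to the common denominator [2^(n + n')], since raising [n] by
    one only doubles [k]; there the numerators agree. *)
Lemma dyadic_fun v h h' : dyadic v h -> dyadic v h' -> h = h'.
Proof.
move=> [k [n [e ->]]] [k' [n' [e' ->]]].
rewrite (dyadic_conj_add k n n') (dyadic_conj_add k' n' n) Nat.add_comm.
congr dyadic_conj; apply: eq_IZR; rewrite !mult_IZR -!pow2_IZR -e -e'; lra.
Qed.

Lemma dyadic_add v h v' h' : dyadic v h -> dyadic v' h' -> dyadic (v + v') (h ** h').
Proof.
move=> [k [n [e ->]]] [k' [n' [e' ->]]].
rewrite (dyadic_conj_add k n n') (dyadic_conj_add k' n' n) Nat.add_comm.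
exists (2 ^ Z.of_nat n' * k + 2 ^ Z.of_nat n * k')%Z, (n + n')%nat; split.
  by rewrite plus_IZR !mult_IZR -!pow2_IZR -e -e' pow_add; lra.
by rewrite /dyadic_conj gpow_add !gmul_assoc gmulK.
Qed.

Lemma dyadic_opp v h : dyadic v h -> dyadic (- v) (ginv h).
Proof.
move=> [k [n [e ->]]]; exists (- k)%Z, n; split; first by rewrite opp_IZR -e; lra.
by rewrite /dyadic_conj gpow_opp !ginv_mul ginvK !gmul_assoc.
Qed.

Lemma dyadic_half v h : dyadic v h -> dyadic (v / 2) (ginv s ** h ** s).
Proof.
move=> [k [n [e ->]]]; exists k, (S n); split; first by rewrite -e /=; field.
rewrite /dyadic_conj Nat2Z.inj_succ -Z.add_1_r gpow_add gpow_1.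
by rewrite ginv_mul !gmul_assoc.
Qed.

Lemma dyadic_double v h : dyadic v h -> dyadic (2 * v) (s ** h ** ginv s).
Proof.
move=> [k [n [e ->]]]; exists (2 * k)%Z, n; split; first by rewrite mult_IZR -e; lra.
have c l : gpow s l ** ginv s = ginv s ** gpow s l.
  by apply: (gmulIr (x := s)); rewrite gmulVK -gmul_assoc -gpow_commg gmulKl.
by rewrite /dyadic_conj -conj_gpow -gpow_opp !gmul_assoc -(gpow_commg s) -gmul_assoc c !gmul_assoc.
Qed.

Lemma dyadic_Z k : dyadic (IZR k) (gpow t k).
Proof.
exists k, O; split; first by rewrite /= Rmult_1_r.
by rewrite /dyadic_conj /= ginv_one gmul_1l gmul_1r.
Qed.

(** Used with exponent [-m] to move [t] past [s^m]: [t s^m = s^m t^(2^-m)]. *)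
Lemma dyadic_pow m : dyadic (powerRZ 2 m) (gpow s m ** t ** ginv (gpow s m)).
Proof.
have two0 : 2 <> 0 by lra.
elim/Z.peano_ind: m => [|m IH|m IH].
- by rewrite /= gmul_1l ginv_one gmul_1r -(gpow_1 t); apply: dyadic_Z.
- have := dyadic_double IH; rewrite -Z.add_1_l powerRZ_add // powerRZ_1.
  by rewrite gpow_add gpow_1 ginv_mul !gmul_assoc.
- have := dyadic_half IH; rewrite -Z.sub_1_r -Z.add_opp_l powerRZ_add // gpow_add ginv_mul.
  have -> : powerRZ 2 (- (1)) * powerRZ 2 m = powerRZ 2 m / 2 by rewrite /= Rmult_1_r; lra.
  by rewrite /= gmul_1r ginvK !gmul_assoc.
Qed.

End Dyadic_powers.

Definition z4eqb (i j : Z4) : bool :=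
  match i, j with i0, i0 | i1, i1 | i2, i2 | i3, i3 => true | _, _ => false end.

Lemma z4eqP i j : z4eqb i j -> i = j.
Proof. by case: i; case: j. Qed.

Lemma z4eqb_refl i : z4eqb i i.
Proof. by case: i. Qed.

Lemma z4eqb_succ i : z4eqb i (z4succ i) = false.
Proof. by case: i. Qed.

Definition singleton i : Z4 -> bool := z4eqb i.
Definition adjacent i : Z4 -> bool := fun k => z4eqb i k || z4eqb (z4succ i) k.

Lemma adjacent_rel i k : adjacent i k -> adjacent i (z4succ k) -> k = i.
Proof. by case: i; case: k. Qed.

Lemma singleton_rel i k : singleton i k -> singleton i (z4succ k) -> False.
Proof. by case: i; case: k. Qed.

Lemma pgood_act_pow (H : Group) (a : Z4 -> H) S (X : oset H) k (p : Sym X) :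
  good a S X -> S k -> (forall x, p x = act k x) ->
  forall n x, lab (pfun (gpow p n) x) = gpow (a k) n ** lab x.
Proof.
move=> g Sk ep n; elim/Z.peano_ind: n => [|n IH|n IH] x.
- by rewrite /= gmul_1l.
- by rewrite !gpow_succ /= ep (pg_act (proj1 g) Sk) IH gmul_assoc.
- rewrite !gpow_pred; apply: (gmulIl (x := a k)).
  by rewrite -(pg_act (proj1 g) Sk) -ep /= pinvK IH !gmul_assoc gmul_Vr gmul_1l.
Qed.

(** * Ordered sets with one more generator, built from dyadic powers and roots *)

Section Affine.
Context {H : Group} {a : Z4 -> H} (rel : higman_relations H a).

(** The group element travels with the number, so labels need no choice of numerator and
    denominator; orders look only at [dv], and [dh_fun] makes labels respect ties. *)
Record dpt (i : Z4) := Dpt {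
  dv : R;
  dh : H;
  dP : dyadic (a i) (a (z4succ i)) dv dh
}.

Definition dadd i (d e : dpt i) : dpt i := Dpt (dyadic_add (rel i) (dP d) (dP e)).
Definition ddouble i (d : dpt i) : dpt i := Dpt (dyadic_double (rel i) (dP d)).
Definition dopp i (d : dpt i) : dpt i := Dpt (dyadic_opp (dP d)).
Definition dhalf i (d : dpt i) : dpt i := Dpt (dyadic_half (dP d)).
Definition dpt_Z i (k : Z) : dpt i := Dpt (dyadic_Z _ _ k).
Definition dpow i (m : Z) : dpt i := Dpt (dyadic_pow (rel i) m).

Lemma dh_fun i (d e : dpt i) : dv d = dv e -> dh d = dh e.
Proof. by move=> ed; apply: (dyadic_fun (rel i) (dP d)); rewrite ed; apply: dP. Qed.

Lemma dh_shift i (d e : dpt i) n : dv d = dv e + IZR n ->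
  dh d = dh e ** gpow (a (z4succ i)) n.
Proof. exact: (@dh_fun i d (dadd e (dpt_Z i n))). Qed.

(* [(d, y)] stands for [a_(i+1)^d y]. *)
Definition affine_oset i (Y : oset H) : oset H := Oset (dpt i * Y)
  (fun u v => lex Rle le (dv u.1, u.2) (dv v.1, v.2))
  (fun u => dh u.1 ** lab u.2)
  (fun k u => if z4eqb i k then (ddouble u.1, act k u.2)
              else if z4eqb (z4succ i) k then (dadd (dpt_Z i 1) u.1, u.2) else u).

Lemma affine_act1 i (Y : oset H) (u : affine_oset i Y) :
  act i u = (ddouble u.1, act i u.2).
Proof. by rewrite /= z4eqb_refl. Qed.

Lemma affine_act2 i (Y : oset H) (u : affine_oset i Y) :
  act (z4succ i) u = (dadd (dpt_Z i 1) u.1, u.2).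
Proof. by rewrite /= z4eqb_succ z4eqb_refl. Qed.

Lemma eqv_Rle x y : eqv Rle x y <-> x = y.
Proof. by rewrite /eqv; split=> [[]|->]; lra. Qed.

Lemma affine_eqv i (Y : oset H) (u v : affine_oset i Y) :
  eqv le u v <-> dv u.1 = dv v.1 /\ eqv le u.2 v.2.
Proof. by rewrite -eqv_Rle; exact: (@eqv_lex _ _ Rle le (dv u.1, u.2) (dv v.1, v.2)). Qed.

(** On the dyadic coordinate the two generators are [v -> 2v] and [v -> v + 1], and
    [2(v + 1) = 2v + 1 + 1]. Halving makes the first one onto. *)
Lemma pgood_affine i (Y : oset H) :
  good a (singleton i) Y -> pgood a (adjacent i) (affine_oset i Y).
Proof.
move=> g; have Si : singleton i i := z4eqb_refl i.
have r := pgood_refl (proj1 g).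
split.
- exact: (tpre_pull (fun u : dpt i * Y => (dv u.1, u.2)) (tpre_lex tpre_Rle (pg_tpre (proj1 g)))).
- by move=> [d x] [e y] /affine_eqv [/= /dh_fun -> /(pg_lab (proj1 g)) ->].
- move=> k /orP [] /z4eqP <- [d x] [e y].
    rewrite !affine_act1 /= /lex /= (pg_mono (proj1 g) Si).
    split; move=> [h1 h2]; (split; first lra) => h3; apply: h2; lra.
  rewrite !affine_act2 /= /lex /=; split; move=> [h1 h2]; (split; first lra) => h3; apply: h2; lra.
- move=> k /orP [] /z4eqP <- [d x].
    by rewrite affine_act1 /= (pg_act (proj1 g) Si) !gmul_assoc gmulVK.
  by rewrite affine_act2 /= gmul_1r !gmul_assoc.
- move=> k /orP [] /z4eqP <- [d y].
    have [x ex] := good_surj g Si y; exists (dhalf d, x).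
    rewrite affine_act1; apply/affine_eqv => /=; rewrite ex; split; last by split.
    lra.
  exists (dadd (dpt_Z i (-1)) d, y).
  rewrite affine_act2; apply/affine_eqv => /=; split; last by split.
  lra.
- move=> k Sk Sk' [d x]; rewrite (adjacent_rel Sk Sk') affine_act1 !affine_act2 affine_act1.
  apply/affine_eqv => /=; split; last by split.
  lra.
Qed.

Definition affine_emb i (Y : oset H) (y : Y) : affine_oset i Y := (dpt_Z i 0, y).

Lemma affine_embP i (Y : oset H) : good a (singleton i) Y -> emb (singleton i) (@affine_emb i Y).
Proof.
move=> g; split.
- move=> x y; rewrite /= /lex /=; split; first by case=> _; apply; lra.
  by split=> //; lra.
- by move=> x; rewrite /= gmul_1l.
- move=> k /z4eqP <- x; rewrite affine_act1; apply/affine_eqv => /=; split.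
    lra.
  by split; apply: (pgood_refl (proj1 g)).
Qed.

Lemma ext_affine i : ext a (singleton i) (adjacent i).
Proof.
move=> Y g; have g' := pgood_affine g.
have [Q [q [r [gQ [eq _]]]]] := quotient g'.
exists Q, (fun y => q (affine_emb i y)); split=> //.
apply: emb_comp (proj1 gQ) (affine_embP g) _; apply: emb_sub eq.
by move=> k; rewrite /adjacent /singleton => ->.
Qed.

(** The clauses of [root_order] for [p = act k], with powers of [p] recorded only through their
    effect on labels. *)
Record root_spec (k : Z4) (Y : oset H) (rle : R * Y -> R * Y -> Prop) : Prop := {
  rs_tpre : tpre rle;
  rs_shift : forall s u v, rle (u.1 + s, u.2) (v.1 + s, v.2) <-> rle u v;
  rs_zero : forall x y, rle (0, x) (0, y) <-> le x y;
  rs_lab : forall u v, eqv rle u v ->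
    exists n, u.1 = v.1 + IZR n /\ lab v.2 = gpow (a k) n ** lab u.2;
  rs_one : forall e x, eqv rle (e + 1, x) (e, act k x)
}.

(** A fixed point [x] of [act k] would satisfy [a k ** lab x = lab x]; so nontriviality of [a k]
    gives the freeness that [root_order] requires. *)
Lemma root_spec_ex k (Y : oset H) : a k <> gone -> good a (singleton k) Y ->
  exists rle, root_spec k (Y := Y) rle.
Proof.
move=> nt g; have Sk : singleton k k := z4eqb_refl k.
have [p ep] := good_perm g Sk.
have [|x|rle [h1 h2 h3 h4 h5]] := @root_order Y le p (pg_tpre (proj1 g)) (proj2 g).
- by move=> x y; rewrite !ep (pg_mono (proj1 g) Sk).
- rewrite ep => e; apply: nt; apply: (gmulIr (x := lab x)).
  by rewrite -(pg_act (proj1 g) Sk) e gmul_1l.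
exists rle; split=> //.
- move=> u v /h4 [n [e1 e2]]; exists n; split=> //.
  by rewrite e2 (pgood_act_pow g Sk ep).
- by move=> e x; rewrite -ep.
Qed.

Lemma rs_lab_dh i (Y : oset H) rle (d e : dpt i) (x y : Y) : root_spec (z4succ i) rle ->
  eqv rle (dv d, x) (dv e, y) -> dh d ** lab x = dh e ** lab y.
Proof.
by move=> rs /(rs_lab rs) [n [/= /dh_shift -> ->]]; rewrite gmul_assoc.
Qed.

(* [(m, (d, y))] stands for [a_i^m a_(i+1)^d y]. *)
Definition root_oset i (Y : oset H) (rle : R * Y -> R * Y -> Prop) : oset H :=
  Oset (Z * (dpt i * Y))
  (fun u v => lex Rle rle (IZR u.1, (dv u.2.1, u.2.2)) (IZR v.1, (dv v.2.1, v.2.2)))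
  (fun u => gpow (a i) u.1 ** (dh u.2.1 ** lab u.2.2))
  (fun k u => if z4eqb i k then (Z.succ u.1, u.2)
              else if z4eqb (z4succ i) k then (u.1, (dadd (dpow i (- u.1)) u.2.1, u.2.2)) else u).

Section Root_oset.
Context (i : Z4) (Y : oset H) (rle : R * Y -> R * Y -> Prop).
Hypothesis rs : root_spec (z4succ i) rle.

Lemma root_act1 (u : root_oset i rle) : act i u = (Z.succ u.1, u.2).
Proof. by rewrite /= z4eqb_refl. Qed.

Lemma root_act2 (u : root_oset i rle) :
  act (z4succ i) u = (u.1, (dadd (dpow i (- u.1)) u.2.1, u.2.2)).
Proof. by rewrite /= z4eqb_succ z4eqb_refl. Qed.

Lemma root_eqv (u v : root_oset i rle) :
  eqv le u v <-> u.1 = v.1 /\ eqv rle (dv u.2.1, u.2.2) (dv v.2.1, v.2.2).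
Proof.
have e : u.1 = v.1 <-> eqv Rle (IZR u.1) (IZR v.1).
  by rewrite eqv_Rle; split=> [->|/eq_IZR].
rewrite e.
exact: (@eqv_lex _ _ Rle rle (IZR u.1, (dv u.2.1, u.2.2)) (IZR v.1, (dv v.2.1, v.2.2))).
Qed.

(** On the copy numbered [m], [a_(i+1)] translates exponents by [2^-m], and [a_i] leads to copy
    [m + 1]; the relation becomes [2^-m = 2 * 2^-(m+1)]. *)
Lemma pgood_root : pgood a (adjacent i) (root_oset i rle).
Proof.
have r := tpre_refl (rs_tpre rs).
have two0 : 2 <> 0 by lra.
split.
- exact: (tpre_pull (fun u : Z * (dpt i * Y) => (IZR u.1, (dv u.2.1, u.2.2)))
                    (tpre_lex tpre_Rle (rs_tpre rs))).
- by move=> [m [d x]] [n [e y]] /root_eqv [/= -> /(rs_lab_dh rs) ->].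
- move=> k /orP [] /z4eqP <- [m [d x]] [n [e y]].
    rewrite !root_act1 /= /lex /= !succ_IZR.
    split; move=> [h1 h2]; (split; first lra) => h3; apply: h2; lra.
  rewrite !root_act2 /= /lex /=.
  split; move=> [h1 h2]; split=> // h3; have := h2 h3;
    have -> : m = n by apply: eq_IZR; lra.
  + by rewrite ![powerRZ _ _ + _]Rplus_comm (rs_shift rs _ (dv d, x) (dv e, y)).
  + by rewrite ![powerRZ _ _ + _]Rplus_comm (rs_shift rs _ (dv d, x) (dv e, y)).
- move=> k /orP [] /z4eqP <- [m [d x]].
    by rewrite root_act1 /= gpow_succ !gmul_assoc.
  by rewrite root_act2 /= !gpow_opp ginvK !gmul_assoc gmul_Vr gmul_1l.
- move=> k /orP [] /z4eqP <- [m [d y]].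
    exists (Z.pred m, (d, y)); rewrite root_act1; apply/root_eqv => /=.
    rewrite Z.succ_pred; split; last by split.
    by [].
  exists (m, (dadd (dopp (dpow i (- m))) d, y)); rewrite root_act2; apply/root_eqv => /=; split.
    by [].
  have -> : powerRZ 2 (- m) + (- powerRZ 2 (- m) + dv d) = dv d by lra.
  by split.
- move=> k Sk Sk' [m [d x]]; rewrite (adjacent_rel Sk Sk') root_act1 !root_act2 root_act1.
  apply/root_eqv => /=; split=> //.
  have -> : powerRZ 2 (- m) = 2 * powerRZ 2 (- Z.succ m).
    by rewrite -[X in X * _](powerRZ_1 2) -powerRZ_add //; congr powerRZ; lia.
  set w := powerRZ _ _; have -> : 2 * w + dv d = w + (w + dv d) by lra.
  by split.
Qed.

Definition root_emb (y : Y) : root_oset i rle := (Z0, (dpt_Z i 0, y)).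

Lemma root_embP : emb (singleton (z4succ i)) root_emb.
Proof.
have r := tpre_refl (rs_tpre rs).
split.
- move=> x y; rewrite -(rs_zero rs) /= /lex /=; split; first by case=> _; apply; lra.
  by split=> //; lra.
- by move=> x; rewrite /= !gmul_1l.
- move=> k /z4eqP <- x; rewrite root_act2; apply/root_eqv => /=; split=> //.
  by rewrite Rplus_comm; apply: eqv_sym; apply: (rs_one rs 0).
Qed.

End Root_oset.

Lemma ext_root i : a (z4succ i) <> gone -> ext a (singleton (z4succ i)) (adjacent i).
Proof.
move=> nt Y g; have [rle rs] := root_spec_ex nt g.
have [Q [q [r [gQ [eq _]]]]] := quotient (pgood_root rs).
exists Q, (fun y => q (root_emb i rle y)); split=> //.
apply: emb_comp (proj1 gQ) (root_embP rs) _; apply: emb_sub eq.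
by move=> k; rewrite /adjacent /singleton => ->; rewrite orbT.
Qed.

(* [(d, (e, y))] stands for [a_(i+1)^d a_(i+2)^e y]: a common home for [a_(i+1)^d y], on which
   [a_i] acts, and for the points with [d] an integer, on which [a_(i+2)] acts. *)
Definition mixed_oset i (Y : oset H) (rle : R * Y -> R * Y -> Prop) : oset H :=
  Oset (dpt i * (dpt (z4succ i) * Y))
  (fun u v => lex Rle rle (dv u.1, (dv u.2.1, u.2.2)) (dv v.1, (dv v.2.1, v.2.2)))
  (fun u => dh u.1 ** (dh u.2.1 ** lab u.2.2))
  (fun k u => (dadd (dpt_Z i 1) u.1, u.2)).

Section Mixed_oset.
Context (i : Z4) (Y : oset H) (rle : R * Y -> R * Y -> Prop).
Hypothesis rs : root_spec (z4succ (z4succ i)) rle.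

Lemma mixed_eqv (u v : mixed_oset i rle) :
  eqv le u v <-> dv u.1 = dv v.1 /\ eqv rle (dv u.2.1, u.2.2) (dv v.2.1, v.2.2).
Proof.
rewrite -eqv_Rle.
exact: (@eqv_lex _ _ Rle rle (dv u.1, (dv u.2.1, u.2.2)) (dv v.1, (dv v.2.1, v.2.2))).
Qed.

Lemma pgood_mixed : pgood a (singleton (z4succ i)) (mixed_oset i rle).
Proof.
have r := tpre_refl (rs_tpre rs).
split.
- exact: (tpre_pull (fun u : dpt i * (dpt (z4succ i) * Y) => (dv u.1, (dv u.2.1, u.2.2)))
                    (tpre_lex tpre_Rle (rs_tpre rs))).
- by move=> [m [d x]] [n [e y]] /mixed_eqv [/= /dh_fun -> /(rs_lab_dh rs) ->].
- move=> k /z4eqP <- [m [d x]] [n [e y]].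
  rewrite /= /lex /=.
  by split; move=> [h1 h2]; (split; first lra) => h3; apply: h2; lra.
- by move=> k /z4eqP <- [m [d x]]; rewrite /= gmul_1r !gmul_assoc.
- move=> k /z4eqP <- [m [d y]]; exists (dadd (dpt_Z i (-1)) m, (d, y)).
  by apply/mixed_eqv => /=; split; [lra|split].
- by move=> k Sk Sk'; case: (singleton_rel Sk Sk').
Qed.

Definition affine_mixed (u : affine_oset i Y) : mixed_oset i rle := (u.1, (dpt_Z _ 0, u.2)).

Lemma affine_mixedP : emb (singleton (z4succ i)) affine_mixed.
Proof.
split.
- by move=> [d x] [e y]; rewrite /= /lex /= (rs_zero rs).
- by move=> [d x]; rewrite /= gmul_1l.
- move=> k /z4eqP <- u; rewrite affine_act2.
  by split; apply: tpre_refl (pg_tpre pgood_mixed) _.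
Qed.

Definition root_mixed (u : root_oset (z4succ i) rle) : mixed_oset i rle := (dpt_Z i u.1, u.2).

Lemma root_mixedP : emb (singleton (z4succ i)) root_mixed.
Proof.
split=> //; move=> k /z4eqP <- u; rewrite root_act1; apply/mixed_eqv => /=; split.
  rewrite succ_IZR; lra.
by split; apply: tpre_refl (rs_tpre rs) _.
Qed.

End Mixed_oset.

End Affine.

(** * Amalgamation *)

(* The automorphisms need not act on a stage: [av] maps each stage to the next one. *)
Section Colimit.
Context {H : Group} (a : Z4 -> H) (I : Z4 -> bool).
Context (St : Type) (X : St -> oset H) (nx : St -> St).
Context (w : forall s, X s -> X (nx s)) (av : forall s, Z4 -> X s -> X (nx s)).
Hypothesis X_tpre : forall s, tpre (@le H (X s)).
Hypothesis X_lab : forall s (x y : X s), eqv le x y -> lab x = lab y.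
Hypothesis w_le : forall s (x y : X s), le (w x) (w y) <-> le x y.
Hypothesis w_lab : forall s (x : X s), lab (w x) = lab x.
Hypothesis av_le : forall i, I i -> forall s (x y : X s), le (av i x) (av i y) <-> le x y.
Hypothesis av_lab : forall i, I i -> forall s (x : X s), lab (av i x) = a i ** lab x.
Hypothesis av_w : forall i, I i -> forall s (x : X s), w (av i x) = av i (w x).
Hypothesis av_surj : forall i, I i -> forall s (y : X s), exists x, av i x = w (w y).
Hypothesis av_rel : forall i, I i -> I (z4succ i) -> forall s (x : X s),
  w (av i (av (z4succ i) x)) = av (z4succ i) (av (z4succ i) (av i x)).

(* [here x] and [there (here (w x))] represent the same point. *)
Inductive colim (s : St) : Type := here (x : X s) | there (u : colim (nx s)).

(** Points of different stages are compared at the later one, after carrying the other along [w];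
    the mixed cases are separate so that each recursion is structural. *)
Fixpoint here_le s (u : colim s) : X s -> Prop :=
  match u with
  | here y => fun x => le x y
  | there u' => fun x => here_le u' (w x)
  end.

Fixpoint le_here s (u : colim s) : X s -> Prop :=
  match u with
  | here x => fun y => le x y
  | there u' => fun y => le_here u' (w y)
  end.

Fixpoint colim_le s (u : colim s) : colim s -> Prop :=
  match u with
  | here x => fun v => here_le v x
  | there u' => fun v => match v with
                         | here y => le_here u' (w y)
                         | there v' => colim_le u' v'
                         end
  end.

Fixpoint colim_lab s (u : colim s) : H :=
  match u with here x => lab x | there u' => colim_lab u' end.

Fixpoint colim_act (i : Z4) s (u : colim s) : colim s :=
  match u with
  | here x => there (here (av i x))
  | there u' => there (colim_act i u')
  end.

Fixpoint depth s (u : colim s) : nat :=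
  match u with here _ => O | there u' => S (depth u') end.

(** The same point seen from the next stage. Each lift lowers positive depths, so finitely many
    points reach depth 0 together, where the axioms are those of a single [X s]; the inductions on a
    depth bound below rest on this. *)
Definition clift s (u : colim s) : colim (nx s) :=
  match u with here x => here (w x) | there u' => u' end.

Lemma depth_lift n s (u : colim s) : (depth u <= S n)%nat -> (depth (clift u) <= n)%nat.
Proof. by case: u => [x|u] /=; lia. Qed.

Lemma clift_le s (u v : colim s) : colim_le (clift u) (clift v) <-> colim_le u v.
Proof. by case: u v => [x|u] [y|v] /=; [apply: w_le| |case: u|]. Qed.

Lemma colim_refl s (u : colim s) : colim_le u u.
Proof. by elim: u => [{}s x|] //=; apply: tpre_refl. Qed.

Lemma tpre_colim s : tpre (@colim_le s).
Proof.
split.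
- suff h n : forall s (u v t : colim s), (depth u <= n)%nat -> (depth v <= n)%nat ->
      (depth t <= n)%nat -> colim_le u v -> colim_le v t -> colim_le u t.
    move=> u v t; pose n := (depth u + depth v + depth t)%nat.
    by apply: (h n); rewrite /n; lia.
  elim: n => [|n IH] {}s.
    move=> [x|u] [y|v] [z|t] /=; try lia.
    by move=> _ _ _; apply: (proj1 (X_tpre s)).
  move=> u v t /depth_lift du /depth_lift dv /depth_lift dt.
  by rewrite -!(clift_le (s := s)); apply: IH.
- suff h n : forall s (u v : colim s), (depth u <= n)%nat -> (depth v <= n)%nat ->
      colim_le u v \/ colim_le v u.
    by move=> u v; apply: (h (depth u + depth v)%nat); lia.
  elim: n => [|n IH] {}s.
    move=> [x|u] [y|v] /=; try lia.
    by move=> _ _; apply: (proj2 (X_tpre s)).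
  move=> u v /depth_lift du /depth_lift dv.
  by rewrite -!(clift_le (s := s)); apply: IH.
Qed.

Lemma clift_lab s (u : colim s) : colim_lab (clift u) = colim_lab u.
Proof. by case: u => [x|u] //=; apply: w_lab. Qed.

Lemma colim_lab_eqv s (u v : colim s) : eqv (@colim_le s) u v -> colim_lab u = colim_lab v.
Proof.
suff h n : forall s (u v : colim s), (depth u <= n)%nat -> (depth v <= n)%nat ->
    eqv (@colim_le s) u v -> colim_lab u = colim_lab v.
  by apply: (h (depth u + depth v)%nat); lia.
elim: n {u v} => [|n IH] {}s u v.
  by case: u v => [x|u] [y|v] /=; try lia; move=> _ _; apply: X_lab.
move=> /depth_lift du /depth_lift dv; rewrite -(clift_lab u) -(clift_lab v) => uv.
by apply: IH => //; case: uv; split; apply/clift_le.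
Qed.

Lemma clift_act i s (u : colim s) : I i ->
  eqv (@colim_le (nx s)) (clift (colim_act i u)) (colim_act i (clift u)).
Proof.
move=> Ii; case: u => [x|u] /=; last by split; apply: colim_refl.
by rewrite /eqv /= (av_w Ii); split; apply: tpre_refl.
Qed.

Lemma colim_act_le i s (u v : colim s) : I i ->
  colim_le (colim_act i u) (colim_act i v) <-> colim_le u v.
Proof.
move=> Ii; suff h n : forall s (u v : colim s), (depth u <= n)%nat -> (depth v <= n)%nat ->
    (colim_le (colim_act i u) (colim_act i v) <-> colim_le u v).
  by apply: (h (depth u + depth v)%nat); lia.
elim: n {u v} => [|n IH] {}s u v.
  by case: u v => [x|u] [y|v] /=; try lia; move=> _ _; apply: av_le.
move=> /depth_lift du /depth_lift dv; rewrite -(clift_le u) -(IH _ _ _ du dv) -clift_le.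
have [u1 u2] := clift_act u Ii; have [v1 v2] := clift_act v Ii.
have t := proj1 (tpre_colim (nx s)).
by split=> h; [apply: t u2 (t _ _ _ h v1)|apply: t u1 (t _ _ _ h v2)].
Qed.

Definition colim_oset s : oset H :=
  Oset (colim s) (@colim_le s) (@colim_lab s) (fun i => @colim_act i s).

Lemma pgood_colim s : pgood a I (colim_oset s).
Proof.
split.
- exact: tpre_colim.
- exact: colim_lab_eqv.
- by move=> i Ii u v; apply: colim_act_le.
- by move=> i Ii; elim=> [{}s x|{}s u IH] //=; apply: av_lab.
- move=> i Ii; elim=> [{}s y|{}s u [v IH]]; last by exists (there v).
  have [x ex] := av_surj Ii y; exists (there (here x)).
  by rewrite /eqv /= ex; split; apply: tpre_refl.
- move=> i Ii Ij; elim=> [{}s x|{}s u IH] //=.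
  by rewrite /eqv /= (av_rel Ii Ij); split; apply: tpre_refl.
Qed.

End Colimit.

Section Amalgam.
Context {H : Group} (a : Z4 -> H) (A B C : Z4 -> bool).
Hypotheses (CA : forall i, C i -> A i) (CB : forall i, C i -> B i).
Hypothesis ABC : forall i, A i -> B i -> C i.
Hypothesis ABrel : forall i, A i || B i -> A (z4succ i) || B (z4succ i) ->
  A i /\ A (z4succ i) \/ B i /\ B (z4succ i).
Hypotheses (extA : ext a C A) (extB : ext a C B).

(* [A] acts on [st_X], [B] on the larger [st_W]; the next stage extends the action of [A] to
   [st_W] and then the action of [B] to the result. *)
Record stage := Stage {
  st_W : oset H;
  st_X : oset H;
  st_f : st_X -> st_W;
  st_gW : good a B st_W;
  st_gX : good a A st_X;
  st_ef : emb C st_f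
}.

Lemma stage_next (s : stage) :
  exists p : {t : stage & (st_W s -> st_W t) * (st_W s -> st_X t)}%type,
  let: existT _ t (w, w1) := p in
  [/\ emb B w, emb C w1, forall x, w x = st_f (w1 x) & emb A (fun x => w1 (st_f (s := s) x))].
Proof.
case: s => W X f gW gX ef /=.
have [W1 [h1 [g1 [e1 e1']]]] := rel_ext extA CA gX (good_sub CB gW) ef.
have [W2 [h2 [g2 [e2 e2']]]] := rel_ext extB CB gW (good_sub CA g1) e1.
by exists (existT _ (Stage g2 g1 e2) (fun x => h2 (h1 x), h1)).
Qed.

Definition next_data s := proj1_sig (constructive_indefinite_description _ (stage_next s)).
Definition nxt s : stage := projT1 (next_data s).
Definition nxt_w s : st_W s -> st_W (nxt s) := (projT2 (next_data s)).1.
Definition nxt_w1 s : st_W s -> st_X (nxt s) := (projT2 (next_data s)).2.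

Lemma nextP s :
  [/\ emb B (@nxt_w s), emb C (@nxt_w1 s), forall x, nxt_w x = st_f (nxt_w1 (s := s) x)
    & emb A (fun x => nxt_w1 (st_f (s := s) x))].
Proof.
rewrite /nxt_w /nxt_w1 /nxt /next_data.
by case: constructive_indefinite_description => [[t [w w1]]] /=.
Qed.

Definition nxt_act s i (x : st_W s) : st_W (nxt s) :=
  if A i then st_f (act i (nxt_w1 x)) else nxt_w (act i x).

Lemma nxt_actA s i (x : st_W s) : A i -> nxt_act i x = st_f (act i (nxt_w1 x)).
Proof. by rewrite /nxt_act => ->. Qed.

(** For [i] in both [A] and [B], [ABC] puts [i] in [C], where [nxt_w1] is equivariant; hence the two
    descriptions of the action agree. *)
Lemma nxt_actB s i (x : st_W s) : B i -> nxt_act i x = nxt_w (act i x).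
Proof.
rewrite /nxt_act; case Ai: (A i) => // Bi; have Ci := ABC Ai Bi.
have [_ e1 -> _] := nextP s.
by rewrite (emb_act_eq e1 (st_gX _)).
Qed.

Lemma nxt_act_f s i (x : st_X s) : A i -> nxt_act i (st_f x) = nxt_w (st_f (act i x)).
Proof.
move=> Ai; have [_ _ -> e] := nextP s.
by rewrite nxt_actA // -(emb_act_eq e (st_gX _)).
Qed.

Lemma amalgam_colim (s : stage) : pgood a (fun i => A i || B i)
  (colim_oset (X := st_W) nxt_w (fun s i x => nxt_act i x) s).
Proof.
apply: pgood_colim => {s}.
- by move=> s; apply: (pg_tpre (proj1 (st_gW s))).
- by move=> s; apply: (pg_lab (proj1 (st_gW s))).
- by move=> s; have [e _ _ _] := nextP s; apply: (emb_le e).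
- by move=> s; have [e _ _ _] := nextP s; apply: (emb_lab e).
- move=> i /orP [Ai|Bi] s x y; have [e e1 _ _] := nextP s.
    rewrite !nxt_actA // (emb_le (st_ef _)) (pg_mono (proj1 (st_gX _)) Ai).
    exact: (emb_le e1).
  by rewrite !nxt_actB // (emb_le e) (pg_mono (proj1 (st_gW _)) Bi).
- move=> i /orP [Ai|Bi] s x; have [e e1 _ _] := nextP s.
    by rewrite nxt_actA // (emb_lab (st_ef _)) (pg_act (proj1 (st_gX _)) Ai) (emb_lab e1).
  by rewrite nxt_actB // (emb_lab e) (pg_act (proj1 (st_gW _)) Bi).
- move=> i /orP [Ai|Bi] s x.
    by have [_ _ ew _] := nextP s; rewrite (nxt_actA _ Ai) ew (nxt_act_f _ Ai).
  have [e _ _ _] := nextP s.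
  by rewrite !nxt_actB // (emb_act_eq e (st_gW _)).
- move=> i /orP [Ai|Bi] s y.
    (* For [i] in [A], a preimage of [y] is available only in [st_X] of the next stage, the first on
       which [act i] is defined at [y]. *)
    have [z ez] := good_surj (st_gX _) Ai (nxt_w1 y).
    have [_ _ ew _] := nextP s.
    by exists (st_f z); rewrite nxt_act_f // ez ew.
  have [z ez] := good_surj (st_gW _) Bi y; have [e _ _ _] := nextP s.
  by exists (nxt_w z); rewrite nxt_actB // -(emb_act_eq e (st_gW _)) // ez.
(* No relation mixes the two sides, so it holds inside some [st_X] or some [st_W]. *)
- move=> i Ii Ij s x; case: (ABrel Ii Ij) => [[Ai Aj]|[Bi Bj]].
    rewrite (nxt_actA x Ai) (nxt_actA x Aj) !nxt_act_f //.
    have [e _ _ _] := nextP (nxt s).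
    have -> : forall z : st_X (nxt s), nxt_act (z4succ i) (nxt_w (st_f (act (z4succ i) z)))
        = nxt_w (nxt_w (st_f (act (z4succ i) (act (z4succ i) z)))).
      move=> z; have [_ _ ew ee] := nextP (nxt s).
      by rewrite !ew nxt_act_f // -(emb_act_eq ee (st_gX _)).
    by rewrite (good_rel (st_gX _) Ai Aj).
  have [e _ _ _] := nextP s; have [e' _ _ _] := nextP (nxt s).
  rewrite !nxt_actB // -(emb_act_eq e (st_gW _) Bi) -(emb_act_eq e' (st_gW _) Bj).
  by rewrite -!(emb_act_eq e (st_gW _) Bj) (good_rel (st_gW _) Bi Bj).
Qed.

(** A first stage needs [B] acting on the whole large set; [rel_ext] over [Z] provides this while
    keeping the given action on [Z]. *)
Lemma amalgam (W X Z : oset H) (f : X -> W) (g : Z -> W) :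
  good a C W -> good a A X -> good a B Z -> emb C f -> emb C g ->
  exists (D : oset H) (h : W -> D), good a (fun i => A i || B i) D /\
    emb A (fun x => h (f x)) /\ emb B (fun x => h (g x)).
Proof.
move=> gW gX gZ ef eg.
have [W0 [h0 [g0 [e0 e0']]]] := rel_ext extB CB gZ gW eg.
pose s := Stage g0 gX (emb_comp (proj1 (good_sub CB g0)) ef e0).
have gc := amalgam_colim s.
have [D [q [r [gD [eq _]]]]] := quotient gc.
pose k (x : W0) : colim_oset (X := st_W) nxt_w (fun s i x => nxt_act i x) s := here (s := s) _ x.
exists D, (fun x => q (k (h0 x))); split=> //.
have tc := pgood_eqv_refl gc.
split.
- suff ek : emb A (fun x : X => k (h0 (f x))).
    by apply: emb_comp (proj1 gD) ek _; apply: emb_sub eq => i ->.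
  split=> [x y|x|i Ai x].
  + by rewrite /k /= (emb_le e0) (emb_le ef).
  + by rewrite /k /= (emb_lab e0) (emb_lab ef).
  + rewrite /eqv /= (nxt_act_f (s := s) _ Ai).
    by split; apply: (pgood_refl (proj1 (st_gW _))).
- suff ek : emb B (fun x : Z => k (h0 (g x))).
    by apply: emb_comp (proj1 gD) ek _; apply: emb_sub eq => i ->; rewrite orbT.
  split=> [x y|x|i Bi x].
  + by rewrite /k /= (emb_le e0) (emb_le eg).
  + by rewrite /k /= (emb_lab e0) (emb_lab eg).
  + rewrite /eqv /= (nxt_actB (s := s) _ Bi) -(emb_act_eq e0' g0 Bi).
    by split; apply: (pgood_refl (proj1 (st_gW _))).
Qed.

End Amalgam.

(** * From one generator to all four *)

Section Assembly.
Context {H : Group} {a : Z4 -> H} (rel : higman_relations H a).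
Hypothesis nt : forall i, a i <> gone.

Definition triple i : Z4 -> bool := fun k => adjacent i k || adjacent (z4succ i) k.
Definition opposite i : Z4 -> bool := fun k => singleton i k || singleton (z4succ (z4succ i)) k.

(** Carries an embedding of preordered sets to their quotients. [rX (qX x)] merely ties with [x];
    antisymmetry of [QY] makes the images equal. *)
Lemma quotient_emb (S S' : Z4 -> bool) (X Y : oset H) (QX QY : oset H) (qX : X -> QX) (rX : QX -> X)
    (qY : Y -> QY) (f : X -> Y) :
  (forall i, S i -> S' i) ->
  emb S' qX -> emb S' rX -> (forall u, qX (rX u) = u) -> emb S qY -> emb S f ->
  good a S' QX -> pgood a S Y -> good a S QY ->
  emb S (fun u => qY (f (rX u))) /\ forall x, qY (f (rX (qX x))) = qY (f x).
Proof.
move=> SS' eqX erX qr eqY ef gX gY gQ; have eqf := emb_comp (proj1 gQ) ef eqY.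
split; first exact: emb_comp (proj1 gQ) (emb_sub SS' erX) eqf.
move=> x; apply: (proj2 gQ); apply/(emb_eqv eqf)/(emb_eqv eqX); rewrite qr.
exact: (pgood_eqv_refl (proj1 gX)).
Qed.

Lemma triple_rel i k :
  adjacent i k || adjacent (z4succ i) k ->
  adjacent i (z4succ k) || adjacent (z4succ i) (z4succ k) ->
  adjacent i k /\ adjacent i (z4succ k) \/ adjacent (z4succ i) k /\ adjacent (z4succ i) (z4succ k).
Proof. by case: i; case: k; auto. Qed.

(** Over [a_(i+1)] alone, [a_i] is added through roots of [a_(i+1)], and [a_(i+2)] through the
    affine construction, where [a_(i+1)] doubles. *)
Lemma amalgam_adjacent i (W X Z : oset H) (f : X -> W) (g : Z -> W) :
  good a (singleton (z4succ i)) W -> good a (adjacent i) X -> good a (adjacent (z4succ i)) Z ->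
  emb (singleton (z4succ i)) f -> emb (singleton (z4succ i)) g ->
  exists (D : oset H) (h : W -> D), good a (triple i) D /\
    emb (adjacent i) (fun x => h (f x)) /\ emb (adjacent (z4succ i)) (fun x => h (g x)).
Proof.
apply: amalgam.
- by move=> k; rewrite /adjacent /singleton => ->; rewrite orbT.
- by move=> k; rewrite /adjacent /singleton => ->.
- by case: i; case.
- exact: triple_rel.
- exact: (ext_root rel (@nt _)).
- exact: (ext_affine rel).
Qed.

(** The affine set extends the action of [a_i] on [Y], the root set that of [a_(i+2)], each by
    [a_(i+1)]. Both lie in the mixed set, compatibly with [a_(i+1)], and are amalgamated inside
    it. *)
Lemma ext_opposite_triple i : ext a (opposite i) (triple i).
Proof.
move=> Y gY.
have g1 : good a (singleton i) Y by apply: good_sub gY => k; rewrite /opposite => ->.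
have g2 : good a (singleton (z4succ (z4succ i))) Y.
  by apply: good_sub gY => k; rewrite /opposite => ->; rewrite orbT.
have [rle rs] := root_spec_ex (@nt _) g2.
have pX := pgood_affine rel g1; have pZ := pgood_root rel rs.
have pW := pgood_mixed rel rs.
have [X [qX [rX [gX [eqX [erX qrX]]]]]] := quotient pX.
have [Z [qZ [rZ [gZ [eqZ [erZ qrZ]]]]]] := quotient pZ.
have [W [qW [_ [gW [eqW _]]]]] := quotient pW.
have s1 : forall k, singleton (z4succ i) k -> adjacent i k.
  by move=> k; rewrite /adjacent /singleton => ->; rewrite orbT.
have s2 : forall k, singleton (z4succ i) k -> adjacent (z4succ i) k.
  by move=> k; rewrite /adjacent /singleton => ->.
have [ef fq] := quotient_emb s1 eqX erX qrX eqW (affine_mixedP rel rs) gX pW gW.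
have [eg gq] := quotient_emb s2 eqZ erZ qrZ eqW (root_mixedP rel rs) gZ pW gW.
have [D [h [gD [hf hg]]]] := amalgam_adjacent gW gX gZ ef eg.
have e1 : emb (singleton i) (fun y => h (qW (affine_mixed rle (affine_emb rel i y)))).
  have : emb (singleton i) (fun y => h (qW (affine_mixed rle (rX (qX (affine_emb rel i y)))))).
    have s : forall k, singleton i k -> adjacent i k.
      by move=> k; rewrite /adjacent /singleton => ->.
    apply: emb_comp (proj1 gD) _ (emb_sub s hf).
    exact: emb_comp (proj1 gX) (affine_embP rel g1) (emb_sub s eqX).
  have qe y : qW (affine_mixed rle (affine_emb rel i y)) =
      qW (affine_mixed rle (rX (qX (affine_emb rel i y)))) by rewrite fq.
  by case=> h1 h2 h3; split=> [x y|x|k Sk x]; rewrite !qe; [apply: h1|apply: h2|apply: h3].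
have e2 : emb (singleton (z4succ (z4succ i)))
    (fun y => h (qW (affine_mixed rle (affine_emb rel i y)))).
  have : emb (singleton (z4succ (z4succ i)))
      (fun y => h (qW (root_mixed (rZ (qZ (root_emb rel (z4succ i) rle y)))))).
    have s : forall k, singleton (z4succ (z4succ i)) k -> adjacent (z4succ i) k.
      by move=> k; rewrite /adjacent /singleton => ->; rewrite orbT.
    apply: emb_comp (proj1 gD) _ (emb_sub s hg).
    exact: emb_comp (proj1 gZ) (root_embP rel rs) (emb_sub s eqZ).
  (* Both routes send [y] to [(0, (0, y))] in the mixed set, so one map on [Y] respects [a_i] and
     [a_(i+2)]. *)
  have qe y : qW (affine_mixed rle (affine_emb rel i y)) =
      qW (root_mixed (rZ (qZ (root_emb rel (z4succ i) rle y)))).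
    by rewrite gq.
  by case=> h1 h2 h3; split=> [x y|x|k Sk x]; rewrite !qe; [apply: h1|apply: h2|apply: h3].
exists D, (fun y => h (qW (affine_mixed rle (affine_emb rel i y)))); split=> //.
case: e1 e2 => h1 h2 h3 [_ _ h4]; split=> // k /orP [] Sk; [exact: h3|exact: h4].
Qed.

Definition empty_oset : oset H :=
  Oset Empty_set (fun _ _ => True) (fun u : Empty_set => match u with end) (fun _ u => u).

Lemma good_empty S : good a S empty_oset.
Proof. by split; [split; [split|..]|] => //; case. Qed.

Definition from_empty (X : oset H) (u : empty_oset) : X := match u with end.

Lemma emb_empty S (X : oset H) : emb S (from_empty X).
Proof. by split=> [[]|[]|? ? []]. Qed.

Definition cyclic_oset i : oset H := Oset Z Z.le (gpow (a i)) (fun _ => Z.succ).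

Lemma good_cyclic i : good a (singleton i) (cyclic_oset i).
Proof.
have anti x y : eqv Z.le x y -> x = y by case; lia.
split=> //; split.
- by split=> [x y z|x y] /=; lia.
- by move=> x y /anti ->.
- by move=> k _ x y /=; lia.
- by move=> k /z4eqP <- x; apply: gpow_succ.
- by move=> k _ y; exists (Z.pred y); rewrite /= Z.succ_pred; split; lia.
- by move=> k Sk Sk'; case: (singleton_rel Sk Sk').
Qed.

(** Amalgamation with empty given parts is plain extension. The integers with [a_1] as successor
    extend to a set with [a_0, a_1, a_2]; restricted to [a_0, a_2], it extends along the two triples
    to all four generators. *)
Lemma higman_oset : exists X : oset H, good a (fun=> true) X /\ inhabited X.
Proof.
have [D [h [gD _]]] := amalgam_adjacent (i := i0) (good_cyclic i1) (good_empty _) (good_empty _)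
  (emb_empty _ _) (emb_empty _ _).
have [X [k [gX _]]] : exists (X : oset H) (k : D -> X),
    good a (fun i => triple i0 i || triple i2 i) X /\
    emb (triple i0) (fun x => k (from_empty D x)) /\ emb (triple i2) (fun x => k (from_empty D x)).
  apply: (@amalgam H a (triple i0) (triple i2) (opposite i0)); try by case; auto.
  - exact: ext_opposite_triple.
  - have -> : opposite i0 = opposite i2 by apply: functional_extensionality; case.
    exact: ext_opposite_triple.
  - by apply: good_sub gD; case.
  - exact: good_empty.
  - exact: good_empty.
  - exact: emb_empty.
  - exact: emb_empty.
exists X; split; last by constructor; apply: (k (h 0%Z)).
by apply: good_sub gX; case.
Qed.

End Assembly.

(** * The order on Higman's group *)

Section Higman_order.
Context {H : Group} {a : Z4 -> H} (hH : is_higman_group H a).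

Lemma sig_ext (P : H -> Prop) (u v : {x | P x}) : proj1_sig u = proj1_sig v -> u = v.
Proof.
case: u v => [x px] [y py] /= e; subst y; congr exist; exact: proof_irrelevance.
Qed.

Definition subgroup (P : H -> Prop) (P1 : P gone)
  (PM : forall x y, P x -> P y -> P (x ** y)) (PV : forall x, P x -> P (ginv x)) : Group.
Proof.
refine (@Build_Group {x | P x}
  (fun u v => exist P _ (PM _ _ (proj2_sig u) (proj2_sig v))) (exist P _ P1)
  (fun u => exist P _ (PV _ (proj2_sig u))) _ _ _ _ _); move=> *; apply: sig_ext => /=.
- exact: gmul_assoc.
- exact: gmul_1l.
- exact: gmul_1r.
- exact: gmul_Vl.
- exact: gmul_Vr.
Defined.

(** The universal property gives a map from [H] to the subgroup [P]; followed by the inclusion it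
    fixes the generators, so by uniqueness it is the identity. *)
Lemma higman_ind (P : H -> Prop) : P gone -> (forall x y, P x -> P y -> P (x ** y)) ->
  (forall x, P x -> P (ginv x)) -> (forall i, P (a i)) -> forall x, P x.
Proof.
move=> P1 PM PV Pa x; case: hH => rel univ.
pose K := subgroup P1 PM PV.
pose b i : K := exist P (a i) (Pa i).
have relK : higman_relations K b.
  by move=> i; apply: sig_ext; apply: rel.
have [f [fM [fa _]]] := univ K b relK.
have [g [_ [_ gu]]] := univ H a rel.
have e1 : proj1_sig (f x) = g x.
  by apply: (gu (fun y => proj1_sig (f y))) => [y z|i]; rewrite ?fM ?fa.
have e2 : x = g x by apply: (gu (fun y => y)).
have <- : proj1_sig (f x) = x by rewrite e1 -e2.
exact: proj2_sig.
Qed.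

(** If [a_k = 1], the relation reads [a_(k+1) = a_(k+1)^2], and triviality spreads around the cycle.
    Thus the order may be built assuming all generators nontrivial. *)
Lemma higman_trivial i : a i = gone -> forall x : H, x = gone.
Proof.
move=> ai; have step k : a k = gone -> a (z4succ k) = gone.
  move=> ak; have := (proj1 hH) k; rewrite ak ginv_one gmul_1l gmul_1r => e.
  by apply: (gmulIl (x := a (z4succ k))); rewrite -e gmul_1r.
have all k : a k = gone.
  by move: ai => /[dup] /step /[dup] /step /[dup] /step; case: i k => [] [].
apply: higman_ind => // [x y -> ->|x ->]; [exact: gmul_1l|exact: ginv_one].
Qed.

Lemma higman_left_orderable : left_orderable H.
Proof.
have [rel univ] := hH.
case: (classic (exists i, a i = gone)) => [[i /higman_trivial tr]|N].
  exists (fun _ _ => True); split; [|split; [|split; [|split]]]; auto.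
  by move=> x y _ _; rewrite (tr x) (tr y).
have nt i : a i <> gone by move=> e; case: N; exists i.
have [X [gX [x0]]] := higman_oset rel nt.
have gp i := constructive_indefinite_description _ (good_perm gX (i := i) erefl).
pose b i : Sym X := proj1_sig (gp i).
have bE i x : b i x = act i x by rewrite /b; case: (gp i).
have relX : higman_relations (Sym X) b.
  move=> i; apply: (gmulIr (x := b i)); rewrite gmulVK; apply: perm_ext => x /=.
  by rewrite !bE (good_rel gX).
have [f [fM [fa _]]] := univ (Sym X) b relX.
have f1 : f gone = gone.
  by apply: (gmulIl (x := f gone)); rewrite -fM !gmul_1r.
have fV h : f (ginv h) = ginv (f h).
  by apply: ginv_uniq; rewrite -fM gmul_Vr.
have fP h : (forall x, lab (f h x) = h ** lab x) /\
            (forall x y, le (f h x) (f h y) <-> le x y).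
  move: h; apply: higman_ind.
  - by rewrite f1; split=> [x|//]; rewrite gmul_1l.
  - move=> g h [g1 g2] [h1 h2]; rewrite fM; split=> [x|x y] /=.
      by rewrite g1 h1 gmul_assoc.
    by rewrite g2 h2.
  - move=> h [h1 h2]; rewrite fV; split=> [x|x y] /=.
      by apply: (gmulIl (x := h)); rewrite -h1 pinvK gmulVKl.
    by rewrite -h2 !pinvK.
  - move=> i; rewrite fa; split=> [x|x y]; rewrite !bE.
      exact: (pg_act (proj1 gX)).
    exact: (pg_mono (proj1 gX)).
have [t o] := pg_tpre (proj1 gX).
exists (fun g h => le (f g x0) (f h x0)); split; [|split; [|split; [|split]]].
- by move=> g; apply: (pgood_refl (proj1 gX)).
(* Tied images of [x0] have equal labels [g ** lab x0] and [h ** lab x0]. *)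
- move=> g h gh hg; apply: (gmulIr (x := lab x0)); rewrite -!(proj1 (fP _)).
  by apply: (pg_lab (proj1 gX)).
- by move=> g h k; apply: t.
- by move=> g h; apply: o.
- by move=> g h k; rewrite !fM /= (proj2 (fP k)).
Qed.

(** * Countability of Higman's group *)

Definition letter (c : nat) : H :=
  match c with
  | 0 => a i0 | 1 => a i1 | 2 => a i2 | 3 => a i3
  | 4 => ginv (a i0) | 5 => ginv (a i1) | 6 => ginv (a i2) | _ => ginv (a i3)
  end%nat.

(** The base-8 digits of [n], least significant first, spell the word. The length is separate
    because the digit 0 is a letter. *)
Fixpoint word (len n : nat) : H :=
  match len with
  | O => gone
  | S l => letter (n mod 8) ** word l (n / 8)
  end.

Lemma word_cons l n c : (c < 8)%nat -> word (S l) (c + n * 8) = letter c ** word l n.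
Proof.
move=> c8; rewrite -[LHS]/(letter ((c + n * 8) mod 8) ** word l ((c + n * 8) / 8)).
by rewrite Nat.Div0.mod_add Nat.mod_small // Nat.div_add // Nat.div_small.
Qed.

Lemma higman_countable : exists e : nat -> H, forall h, exists n, e n = h.
Proof.
exists (fun n => let (l, k) := Cantor.of_nat n in word l k).
suff w h : exists l k, word l k = h.
  move=> h; have [l [k <-]] := w h; exists (Cantor.to_nat (l, k)).
  by rewrite Cantor.cancel_of_to.
(* Left multiplication by [g] and by its inverse are treated together, so that the induction over
   [H] passes to inverses without reversing words. *)
pose Q g := forall h, (exists l k, word l k = h) -> exists l k, word l k = g ** h.
have Qletter c : (c < 8)%nat -> Q (letter c).
  by move=> c8 _ [l [k <-]]; exists (S l), (c + k * 8)%nat; apply: word_cons.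
suff QQ : Q h /\ Q (ginv h).
  by rewrite -(gmul_1r _ h); apply: (proj1 QQ); exists O, O.
move: h; apply: higman_ind.
- by rewrite ginv_one; split=> h; rewrite gmul_1l.
- move=> x y [x1 x2] [y1 y2]; split=> h hw; rewrite ?ginv_mul -gmul_assoc.
    by apply/x1/y1.
  by apply/y2/x2.
- by move=> x [x1 x2]; rewrite ginvK.
- case; split.
  + by apply: (Qletter 0%nat); lia.
  + by apply: (Qletter 4%nat); lia.
  + by apply: (Qletter 1%nat); lia.
  + by apply: (Qletter 5%nat); lia.
  + by apply: (Qletter 2%nat); lia.
  + by apply: (Qletter 6%nat); lia.
  + by apply: (Qletter 3%nat); lia.
  + by apply: (Qletter 7%nat); lia.
Qed.

End Higman_order.

(** * Actions of countable left-ordered groups on the line *)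

Definition unbounded_dense {T} (le : T -> T -> Prop) : Prop :=
  [/\ forall x y, ~ le y x -> exists z, ~ le z x /\ ~ le y z,
      forall x, exists z, ~ le z x & forall x, exists z, ~ le x z].

Lemma list_max T (le : T -> T -> Prop) (x : T) (l : list T) : tpre le ->
  exists m, In m (x :: l) /\ forall y, In y (x :: l) -> le y m.
Proof.
move=> [t o]; elim: l x => [|y l IH] x.
  by exists x; split=> [|y [<-|//]]; [left|case: (o x x)].
have [m [mi mm]] := IH y; case: (o x m) => xm.
  by exists m; split=> [|z [<-//|/mm]]; first right.
exists x; split=> [|z [<-|/mm zm]]; [by left|by case: (o x x)|exact: t zm xm].
Qed.

Lemma tpre_flip T (le : T -> T -> Prop) : tpre le -> tpre (fun x y => le y x).
Proof. by move=> [t o]; split=> *; [apply: t; eassumption|apply: o]. Qed.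

Lemma list_between T (le : T -> T -> Prop) (x0 : T) (l1 l2 : list T) :
  tpre le -> unbounded_dense le ->
  (forall x y, In x l1 -> In y l2 -> ~ le y x) ->
  exists z, (forall x, In x l1 -> ~ le z x) /\ (forall y, In y l2 -> ~ le y z).
Proof.
move=> tp [d u l] h; have [t o] := tp.
case: l1 l2 h => [|x l1] [|y l2] h.
- by exists x0; split.
- have [m [mi mm]] := list_max y l2 (tpre_flip tp).
  have [z zm] := l m; exists z; split=> // w /mm mw wz; apply: zm; exact: t mw wz.
- have [m [mi mm]] := list_max x l1 tp.
  have [z zm] := u m; exists z; split=> // w /mm wm zw; apply: zm; exact: t zw wm.
- have [m [mi mm]] := list_max x l1 tp; have [m' [mi' mm']] := list_max y l2 (tpre_flip tp).
  have [z [z1 z2]] := d _ _ (h _ _ mi mi'); exists z; split=> w.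
    by move=> /mm wm zw; apply: z1; apply: t zw wm.
  by move=> /mm' mw wz; apply: z2; apply: t mw wz.
Qed.

Definition partial_iso (le1 le2 : nat -> nat -> Prop) (L : list (nat * nat)) :=
  forall p q, In p L -> In q L -> (le1 p.1 q.1 <-> le2 p.2 q.2).

Lemma forth (le1 le2 : nat -> nat -> Prop) L m : tpre le1 -> tpre le2 -> unbounded_dense le2 ->
  partial_iso le1 le2 L -> exists n, partial_iso le1 le2 ((m, n) :: L).
Proof.
move=> t1 t2 d2 iso.
have r1 := tpre_refl t1; have r2 := tpre_refl t2.
have [tr1 o1] := t1; have [tr2 o2] := t2.
(* Ties are allowed: an [m] tied with an earlier entry takes over its partner; otherwise a partner
   is sought strictly between the lower and the upper entries. *)
case: (classic (exists p, In p L /\ eqv le1 p.1 m)) => [[p [pL [pm mp]]]|N].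
  exists p.2 => q q' [<-|qL] [<-|qL'] //=.
  - rewrite -(iso _ _ pL qL'); split=> h; [exact: tr1 pm h|exact: tr1 mp h].
  - rewrite -(iso _ _ qL pL); split=> h; [exact: tr1 h mp|exact: tr1 h pm].
  - exact: iso.
pose lo := filter (fun p => if excluded_middle_informative (le1 p.1 m) then true else false) L.
pose hi := filter (fun p => if excluded_middle_informative (le1 p.1 m) then false else true) L.
have loP p : In p lo <-> In p L /\ le1 p.1 m.
  by rewrite filter_In; case: excluded_middle_informative => h; split; case=> //; tauto.
have hiP p : In p hi <-> In p L /\ ~ le1 p.1 m.
  by rewrite filter_In; case: excluded_middle_informative => h; split; case=> //; tauto.
have [|n [n1 n2]] := @list_between _ le2 0%nat (map snd lo) (map snd hi) t2 d2.
  move=> _ _ /in_map_iff [p [<- /loP [pL pm]]] /in_map_iff [q [<- /hiP [qL qm]]].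
  rewrite -(iso _ _ qL pL) => qp; apply: qm; exact: tr1 qp pm.
have lo_lt p : In p L -> le1 p.1 m -> ~ le1 m p.1 /\ ~ le2 n p.2.
  move=> pL pm; split=> [mp|]; first by apply: N; exists p.
  by apply: n1; apply/in_map_iff; exists p; split=> //; apply/loP.
have hi_lt p : In p L -> ~ le1 p.1 m -> le1 m p.1 /\ ~ le2 p.2 n.
  move=> pL pm; split; first by case: (o1 m p.1).
  by apply: n2; apply/in_map_iff; exists p; split=> //; apply/hiP.
exists n => q q' [<-|qL] [<-|qL'] //=.
- case: (classic (le1 q'.1 m)) => h.
    by have [h1 h2] := lo_lt _ qL' h; tauto.
  by have [h1 h2] := hi_lt _ qL' h; case: (o2 n q'.2); tauto.
- case: (classic (le1 q.1 m)) => h.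
    by have [h1 h2] := lo_lt _ qL h; case: (o2 n q.2); tauto.
  by have [h1 h2] := hi_lt _ qL h; tauto.
- exact: iso.
Qed.

Lemma partial_iso_flip (le1 le2 : nat -> nat -> Prop) L :
  partial_iso le1 le2 L -> partial_iso le2 le1 (map (fun p => (p.2, p.1)) L).
Proof.
move=> iso _ _ /in_map_iff [p [<- pL]] /in_map_iff [q [<- qL]] /=.
by rewrite (iso p q).
Qed.

(** The union of a chain of finite partial isomorphisms, step [k] giving a partner to [k] on either
    side. It is a relation: a number may acquire several, mutually tied, partners. *)
Lemma back_and_forth (le1 le2 : nat -> nat -> Prop) : tpre le1 -> tpre le2 ->
  unbounded_dense le1 -> unbounded_dense le2 ->
  exists r : nat -> nat -> Prop,
    [/\ forall m n m' n', r m n -> r m' n' -> (le1 m m' <-> le2 n n'),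
        forall m, exists n, r m n & forall n, exists m, r m n].
Proof.
move=> t1 t2 d1 d2.
pose T := {L | partial_iso le1 le2 L}.
have step (k : nat) (u : T) : {v : T | [/\ incl (proj1_sig u) (proj1_sig v),
    exists n, In (k, n) (proj1_sig v) & exists m, In (m, k) (proj1_sig v)]}.
  apply: constructive_indefinite_description; case: u => L iso.
  have [n iso1] := forth k t1 t2 d2 iso.
  have [m iso2] := forth k t2 t1 d1 (partial_iso_flip iso1).
  have e (l : list (nat * nat)) : map (fun p => (p.2, p.1)) (map (fun p => (p.2, p.1)) l) = l.
    by elim: l => [|[x y] l /= ->].
  have := partial_iso_flip iso2; rewrite /= e => iso3; exists (exist _ _ iso3); split=> /=.
  - by move=> p pL; right; right.
  - by exists n; right; left.
  - by exists m; left.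
have iso0 : partial_iso le1 le2 nil by move=> p q [].
pose L := fix L k : T := match k with O => exist _ nil iso0 | S l => proj1_sig (step l (L l)) end.
have LS l : [/\ incl (proj1_sig (L l)) (proj1_sig (L (S l))),
    exists n, In (l, n) (proj1_sig (L (S l))) & exists m, In (m, l) (proj1_sig (L (S l)))].
  by rewrite /=; case: (step l (L l)).
have mono k l : incl (proj1_sig (L k)) (proj1_sig (L (k + l)%nat)).
  elim: l => [|l IH]; first by rewrite Nat.add_0_r => p.
  rewrite Nat.add_succ_r => p /IH; have [h _ _] := LS (k + l)%nat; exact: h.
exists (fun m n => exists k, In (m, n) (proj1_sig (L k))); split.
- move=> m n m' n' [k h] [k' h'].
  apply: (proj2_sig (L (k + k')%nat) (m, n) (m', n')); first exact: mono.
  by rewrite Nat.add_comm; apply: mono.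
- by move=> m; have [_ [n h] _] := LS m; exists n, (S m).
- by move=> n; have [_ _ [m h]] := LS n; exists m, (S n).
Qed.

(** * Extending order isomorphisms between dense sets of reals *)

Section Extension_to_the_line.

Definition dense_iso (M : R -> R -> Prop) : Prop :=
  [/\ forall r r' t t', M r r' -> M t t' -> (r <= t <-> r' <= t'),
      forall x y, x < y -> exists r r', [/\ M r r', x < r & r < y]
    & forall x y, x < y -> exists r r', [/\ M r r', x < r' & r' < y]].

(* Symmetric in [s] and [y] (lemma [limit_of_flip]), so that monotone extension needs no separate
   treatment of inverses. *)
Definition limit_of (M : R -> R -> Prop) (s y : R) : Prop :=
  forall r r', M r r' -> (r < s -> r' <= y) /\ (s < r -> y <= r').

Context (M : R -> R -> Prop).

Lemma limit_of_flip s y : limit_of M s y -> limit_of (fun x y => M y x) y s.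
Proof.
move=> h r r' /h [h1 h2]; split=> h3.
  by case: (Rle_or_lt r' s) => // /h2; lra.
by case: (Rle_or_lt s r') => // /h1; lra.
Qed.

Hypothesis dM : dense_iso M.

(** A further point of the domain between [r] and [s] satisfies the weak bound, and [r'] lies
    strictly beyond it. *)
Lemma limit_of_lt s y r r' : limit_of M s y -> M r r' -> (r < s -> r' < y) /\ (s < r -> y < r').
Proof.
have [iso d _] := dM; move=> lim m; split=> /d [t [t' [mt h1 h2]]];
  have [l1 l2] := lim _ _ mt.
- have := l1 h2; case: (Rlt_or_le r' t') => [|h]; first lra.
  have := proj2 (iso _ _ _ _ mt m) h; lra.
- have := l2 h1; case: (Rlt_or_le t' r') => [|h]; first lra.
  have := proj2 (iso _ _ _ _ m mt) h; lra.
Qed.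

Lemma limit_of_ex s : exists y, limit_of M s y.
Proof.
have [iso d _] := dM.
have lt_mono r r' t t' : M r r' -> M t t' -> r < t -> r' <= t'.
  by move=> m m' rt; apply/(iso _ _ _ _ m m'); lra.
have [t [t' [mt st _]]] : exists r r', [/\ M r r', s < r & r < s + 1] by apply: d; lra.
have [u [u' [mu _ us]]] : exists r r', [/\ M r r', s - 1 < r & r < s] by apply: d; lra.
(* The limit is the supremum of the values at points left of [s]. *)
pose E r' := exists r, M r r' /\ r < s.
have bE : bound E by exists t' => r' [r [m rs]]; apply: lt_mono m mt _; lra.
have nE : exists r', E r' by exists u', u.
have [y [ub lub]] := completeness E bE nE.
exists y => r r' m; split=> h; first by apply: ub; exists r.
by apply: lub => p' [p [mp ps]]; apply: lt_mono mp m _; lra.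
Qed.

(** Of two values in the range strictly between two limits, the smaller would come from a point at
    or right of [s] and the larger from one at or left of [s], against monotonicity. *)
Lemma limit_of_uniq s y y' : limit_of M s y -> limit_of M s y' -> y = y'.
Proof.
have [iso _ d] := dM.
suff h z z' : limit_of M s z -> limit_of M s z' -> ~ z < z'.
  by move=> l l'; have := h _ _ l l'; have := h _ _ l' l; lra.
move=> l l' zz; have [r [r' [m h1 h2]]] := d _ _ zz; have [t [t' [mt h3 h4]]] := d _ _ h1.
have [_ c1] := limit_of_flip l mt; have [c2 _] := limit_of_flip l' m.
have rt : r <= t by have := c1 h3; have := c2 h2; lra.
by have := proj1 (iso _ _ _ _ m mt) rt; lra.
Qed.

Lemma limit_of_point r r' : M r r' -> limit_of M r r'.
Proof.
have [iso _ _] := dM; move=> m t t' mt.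
by split=> h; [apply/(iso _ _ _ _ mt m)|apply/(iso _ _ _ _ m mt)]; lra.
Qed.

Lemma limit_of_mono s y t z : limit_of M s y -> limit_of M t z -> s < t -> y < z.
Proof.
have [_ d _] := dM; move=> l l' /d [r [r' [m h1 h2]]].
by have := proj2 (limit_of_lt l m) h1; have := proj1 (limit_of_lt l' m) h2; lra.
Qed.

End Extension_to_the_line.

Lemma limit_of_comp (M N K : R -> R -> Prop) s y z : dense_iso M ->
  (forall r r'', K r r'' -> exists r', M r r' /\ N r' r'') ->
  dense_iso N -> limit_of M s y -> limit_of N y z -> limit_of K s z.
Proof.
move=> dM MNK dN lM lN r r'' /MNK [r' [m n]].
have [m1 m2] := limit_of_lt dM lM m; have [n1 n2] := lN _ _ n.
by split=> h; [apply/n1/m1|apply/n2/m2].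
Qed.

(** The preimages of [f x - eps] and [f x + eps] under [f] bound a neighbourhood of [x]. *)
Lemma increasing_bij_continuous (f g : R -> R) : (forall x y, x < y -> f x < f y) ->
  (forall x y, x < y -> g x < g y) -> (forall x, g (f x) = x) -> (forall x, f (g x) = x) ->
  continuity f.
Proof.
move=> fm gm gf fg x eps e0.
have h1 : g (f x - eps) < x by rewrite -[X in _ < X]gf; apply: gm; lra.
have h2 : x < g (f x + eps) by rewrite -[X in X < _]gf; apply: gm; lra.
exists (Rmin (x - g (f x - eps)) (g (f x + eps) - x)); split.
  by apply: Rmin_glb_lt; lra.
move=> y [_]; rewrite /= /R_dist => /Rmin_Rgt_l [/Rabs_def2 [a1 a2] /Rabs_def2 [a3 a4]].
apply: Rabs_def1.
  by have : f y < f (g (f x + eps)) by [apply: fm; lra]; rewrite fg; lra.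
by have : f (g (f x - eps)) < f y by [apply: fm; lra]; rewrite fg; lra.
Qed.

Lemma dense_sequence : exists q : nat -> R, forall x y, x < y -> exists n, x < q n /\ q n < y.
Proof.
exists (fun n => let (c, k) := Cantor.of_nat n in let (i, j) := Cantor.of_nat k in
  (INR i - INR j) / INR (S c)) => x y xy.
have [c c1] : exists c, / INR (S c) < y - x.
  have [N [h1 h2]] := archimed_cor1 (y - x) ltac:(lra).
  by exists (Nat.pred N); rewrite (Nat.lt_succ_pred 0).
have p : 0 < INR (S c) by apply: lt_0_INR; lia.
(* The integer [k] exceeds [x (c + 1)] by at most 1, hence stays below [y (c + 1)]. It is coded as a
   difference of naturals, one of them 0. *)
have [u1 u2] := archimed (x * INR (S c)); set k := up _ in u1 u2.
exists (Cantor.to_nat (c, Cantor.to_nat (Z.to_nat k, Z.to_nat (- k)))).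
rewrite !Cantor.cancel_of_to.
have -> : INR (Z.to_nat k) - INR (Z.to_nat (- k)) = IZR k.
  by rewrite !INR_IZR_INZ -minus_IZR; congr IZR; lia.
have c2 : 1 < (y - x) * INR (S c).
  by have := Rmult_lt_compat_r _ _ _ p c1; rewrite Rinv_l; lra.
split; apply: (Rmult_lt_reg_r (INR (S c))) => //; rewrite /Rdiv Rmult_assoc Rinv_l; lra.
Qed.

Lemma left_orderable_action (G : Group) :
  left_orderable G -> (exists e : nat -> G, forall g, exists n, e n = g) ->
  faithful_homeo_action G.
Proof.
move=> [leG [rf [an [tr [to li]]]]] [e eP]; have [q qP] := dense_sequence.
have tG : tpre leG by split.
have liE h f g : leG (h ** f) (h ** g) <-> leG f g.
  split; last exact: li.
  by move=> /(li _ _ (ginv h)); rewrite !gmulKl.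
(* A natural number codes a pair of a group element and a value of [q]. Different numbers may code
   the same pair, so [le1] is only a preorder. *)
pose fi n := e (Cantor.of_nat n).1; pose se n := q (Cantor.of_nat n).2.
have pr g n : exists m, fi m = g /\ se m = q n.
  have [k ek] := eP g; exists (Cantor.to_nat (k, n)).
  by rewrite /fi /se Cantor.cancel_of_to.
pose le1 m n := lex leG Rle (fi m, se m) (fi n, se n).
pose le2 m n := q m <= q n.
have t1 : tpre le1 by exact: (tpre_pull (fun m => (fi m, se m)) (tpre_lex tG tpre_Rle)).
have t2 : tpre le2 by exact: (tpre_pull q tpre_Rle).
have lt1 m n : ~ le1 n m <-> leG (fi m) (fi n) /\ (leG (fi n) (fi m) -> se m < se n).
  rewrite /le1 /lex /=; split=> [N|[mn s] [nm s']]; last by have := s nm; have := s' mn; lra.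
  case: (classic (leG (fi m) (fi n))) => mn; last by case: N; split=> //; case: (to (fi m) (fi n)).
  by split=> // nm; apply: Rnot_le_lt => s; apply: N; split.
have d2 : unbounded_dense le2.
  split=> [x y /Rnot_le_lt /qP [n [n1 n2]]|x|x].
  - by exists n; split; apply: Rlt_not_le.
  - by have [n [n1 _]] := qP (q x) (q x + 1) ltac:(lra); exists n; apply: Rlt_not_le.
  - by have [n [_ n1]] := qP (q x - 1) (q x) ltac:(lra); exists n; apply: Rlt_not_le.
have d1 : unbounded_dense le1.
  split=> [x y /lt1 [h1 h2]|x|x].
  - case: (classic (leG (fi y) (fi x))) => h3.
      have [n [n1 n2]] := qP _ _ (h2 h3); have [z [z1 z2]] := pr (fi x) n.
      by exists z; split; apply/lt1; rewrite z1 z2; split.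
    have [n [n1 n2]] := qP (se x) (se x + 1) ltac:(lra); have [z [z1 z2]] := pr (fi x) n.
    by exists z; split; apply/lt1; rewrite z1 z2; split.
  - have [n [n1 n2]] := qP (se x) (se x + 1) ltac:(lra); have [z [z1 z2]] := pr (fi x) n.
    by exists z; apply/lt1; rewrite z1 z2; split.
  - have [n [n1 n2]] := qP (se x - 1) (se x) ltac:(lra); have [z [z1 z2]] := pr (fi x) n.
    by exists z; apply/lt1; rewrite z1 z2; split.
have [T [Tiso T1 T2]] := back_and_forth t1 t2 d1 d2.
(* [M g] relates the real positions of [(x, s)] and [(g x, s)]: left translation by [g] seen on
   values of [q]. *)
pose M g r r' := exists m m' n n',
  [/\ fi m' = g ** fi m, se m' = se m & [/\ T m n, T m' n', r = q n & r' = q n']].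
have dM g : dense_iso (M g).
  split.
  - move=> _ _ _ _ [m [m' [n [n' [f1 s1 [a1 b1 -> ->]]]]]] [k [k' [l [l' [f2 s2 [a2 b2 -> ->]]]]]].
    rewrite -[q n <= q l]/(le2 n l) -[q n' <= q l']/(le2 n' l').
    by rewrite -(Tiso _ _ _ _ a1 a2) -(Tiso _ _ _ _ b1 b2) /le1 /lex /= f1 f2 s1 s2 !liE.
  - move=> x y /qP [n [n1 n2]]; have [m mn] := T2 n.
    have [m' [e1 e2]] := pr (g ** fi m) (Cantor.of_nat m).2; have [n' mn'] := T1 m'.
    by exists (q n), (q n'); split=> //; exists m, m', n, n'.
  - move=> x y /qP [n' [n1 n2]]; have [m' mn'] := T2 n'.
    have [m [e1 e2]] := pr (ginv g ** fi m') (Cantor.of_nat m').2; have [n mn] := T1 m.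
    by exists (q n), (q n'); split=> //; exists m, m', n, n'; rewrite e1 e2 gmulVKl.
pose rho g s := proj1_sig (constructive_indefinite_description _ (limit_of_ex (dM g) s)).
have rhoP g s : limit_of (M g) s (rho g s).
  by rewrite /rho; case: constructive_indefinite_description.
have rhoM g h s : rho (g ** h) s = rho g (rho h s).
  apply: (limit_of_uniq (dM (g ** h)) (rhoP _ _)).
  apply: (@limit_of_comp (M h) (M g) (M (g ** h)) s (rho h s)) => //.
  move=> _ _ [m [m' [n [n' [f1 s1 [a1 b1 -> ->]]]]]].
  have [k [e1 e2]] := pr (h ** fi m) (Cantor.of_nat m).2; have [l kl] := T1 k.
  exists (q l); split; first by exists m, k, n, l.
  by exists k, m', l, n'; rewrite e1 gmul_assoc; split=> //; rewrite s1 e2.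
have rho_mono g s t : s < t -> rho g s < rho g t.
  exact: (limit_of_mono (dM g) (rhoP g s) (rhoP g t)).
(* An idempotent strictly increasing map is the identity. *)
have rho1 s : rho gone s = s.
  have idem : rho gone (rho gone s) = rho gone s by rewrite -rhoM gmul_1l.
  case: (Rtotal_order (rho gone s) s) => [|[//|]] /(rho_mono gone); rewrite idem; lra.
have rhoV g s : rho (ginv g) (rho g s) = s by rewrite -rhoM gmul_Vl.
have rhoVK g s : rho g (rho (ginv g) s) = s by rewrite -rhoM gmul_Vr.
exists rho; split; [|split] => //.
- move=> g; exists (rho (ginv g)); split; [|split; [|split]] => //.
    exact: increasing_bij_continuous (rho_mono _) (rho_mono _) (rhoV _) (rhoVK _).
  exact: increasing_bij_continuous (rho_mono _) (rho_mono _) (rhoVK _) (rhoV _).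
(* Faithfulness is seen at the position of [(1, q 0)], which goes to positions of [(g, q 0)] and
   [(h, q 0)]; if these agree, the pairs tie and [g = h]. *)
- move=> g h gh; have [m [m1 m2]] := pr gone 0%nat; have [n mn] := T1 m.
  have [mg [g1 g2]] := pr g 0%nat; have [ng mng] := T1 mg.
  have [mh [h1 h2]] := pr h 0%nat; have [nh mnh] := T1 mh.
  have eg : q ng = rho g (q n).
    apply: (limit_of_uniq (dM g)) (rhoP _ _); apply: (limit_of_point (dM g)).
    by exists m, mg, n, ng; rewrite m1 gmul_1r m2 g2.
  have eh : q nh = rho h (q n).
    apply: (limit_of_uniq (dM h)) (rhoP _ _); apply: (limit_of_point (dM h)).
    by exists m, mh, n, nh; rewrite m1 gmul_1r m2 h2.
  have eq : q ng = q nh by rewrite eg eh gh.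
  rewrite -g1 -h1; apply: an.
    by have : le1 mg mh by [apply/(Tiso _ _ _ _ mng mnh); rewrite /le2 eq; lra]; case.
  by have : le1 mh mg by [apply/(Tiso _ _ _ _ mnh mng); rewrite /le2 eq; lra]; case.
Qed.

Unset Implicit Arguments.
Theorem theoremA (H : Group) (a : Z4 -> H) :
  is_higman_group H a ->
  left_orderable H /\ faithful_homeo_action H.
Proof.
move=> hH; have lo := higman_left_orderable hH.
by split=> //; apply: left_orderable_action lo (higman_countable hH).
Qed.
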